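(* Let $(\bar x,\bar\lambda)=(\bar x^1,\dots,\bar x^N,\bar\lambda^1,\dots,\bar\lambda^N)\in S_{\rm KKT}(\bar p)$. Suppose that: (i) the SCSC holds for each player $k$ at $(\bar p^k,\bar x^k,\bar\lambda^k)$; (ii) the LICQ holds for each player $k$ at $(\bar p^k,\bar x^k)$; (iii) the SOSC holds for each player $k$ at $(\bar p^k,\bar x^k,\bar\lambda^k)$; (iv) there exist parameters $\alpha_{i,j}>0$ ($1\le i,j\le N$, $j\ne i$) with $\sum_{j\ne i}\alpha_{i,j}=1$ for $i=1,\dots,N$, such that, with $A_{ki}:=\nabla^2_{x^kx^i}L^k+(\nabla^2_{x^ix^k}L^i)^{\mathrm T}$, for all players $i\neq k$ and any $0\ne y^k\in M^k$, $$(y^k)^{\mathrm T}\left(\nabla^2_{x^kx^k}L^k-\frac{1}{4\alpha_{i,k}\alpha_{k,i}}A_{ik}^{\mathrm T}B^i\left((B^i)^{\mathrm T}\nabla^2_{x^ix^i}L^iB^i\right)^{-1}(B^i)^{\mathrm T}A_{ik}\right)y^k>0 .$$ Then $S_{\rm KKT}$ has a continuously differentiable single-valued localization around $\bar p$ for $(\bar x,\bar\lambda)$, and for every $(p,x(p),\lambda(p))\in{\rm gph}\,S_{\rm KKT}$ sufficiently close to $(\bar p,\bar x,\bar\lambda)$, $x(p)$ is a local Nash equilibrium at $p$.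
   Context: Nash equilibrium problem (NEP) with canonical perturbations. There are $N$ players; player $k$ has strategy $x^k\in\mathbb R^{n_k}$; $x=(x^1,\dots,x^N)\in\mathbb R^n$, $n=n_1+\cdots+n_N$; $x^{-k}$ denotes the other players' strategies. Parameters: $p^k=(u^k,v^k,w^k)\in\mathbb R^{m_k}\times\mathbb R^{n_k}\times\mathbb R^{d_k}$, $p=(p^1,\dots,p^N)$, identified with $(u,v,w)\in\mathbb R^{m}\times\mathbb R^n\times\mathbb R^d$, $m=\sum m_k$, $d=\sum d_k$. Given $x^{-k},p^k$, player $k$ solves the problem $\mathbf P^k(x^{-k},p^k)$: $$\min_{x^k}\ f^k(x^k,x^{-k};w^k)-\langle v^k,x^k\rangle\ \text{ s.t. } g^k_i(x^k;w^k)=u^k_i\ (i=1,\dots,s_k),\ \ g^k_j(x^k;w^k)\le u^k_j\ (j=s_k+1,\dots,m_k),$$ with $f^k\in C^2(\mathbb R^n\times\mathbb R^{d_k})$, $g^k_i\in C^2(\mathbb R^{n_k}\times\mathbb R^{d_k})$. A point $x$ is a local Nash equilibrium (LNE) at $p$ if each $x^k$ is a local minimizer of $\mathbf P^k(x^{-k},p^k)$. Lagrangian: $L^k(x^k,x^{-k},\lambda^k;w^k)=f^k(x^k,x^{-k};w^k)+\sum_{i=1}^{m_k}\lambda^k_ig^k_i(x^k;w^k)$. KKT mapping: $S_{\rm KKT}(p)$ is the set of $(x,\lambda)\in\mathbb R^n\times\mathbb R^m$ such that for each $k$: $v^k=\nabla_{x^k}L^k(x^k,x^{-k},\lambda^k;w^k)$;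 $g^k_i(x^k;w^k)=u^k_i$ for $i\le s_k$; and $\lambda^k_j\ge0$, $g^k_j(x^k;w^k)\le u^k_j$, $\lambda^k_j(g^k_j(x^k;w^k)-u^k_j)=0$ for $j>s_k$. Notation at $(\bar p,\bar x,\bar\lambda)\in{\rm gph}\,S_{\rm KKT}$: $\nabla^2_{x^kx^i}L^k\in\mathbb R^{n_k\times n_i}$ is the matrix of second partials $\partial^2L^k/\partial x^k_a\partial x^i_b$ evaluated at $(\bar x^k,\bar x^{-k},\bar\lambda^k;\bar w^k)$. Index sets: $I^k_1=\{1,\dots,s_k\}\cup\{i\in[s_k+1,m_k]:\bar\lambda^k_i>0=g^k_i(\bar x^k;\bar w^k)-\bar u^k_i\}$, $I^k_2=\{i\in[s_k+1,m_k]:\bar\lambda^k_i=0=g^k_i(\bar x^k;\bar w^k)-\bar u^k_i\}$. $M^k=\{y^k\in\mathbb R^{n_k}:\nabla_{x^k}g^k_i(\bar x^k;\bar w^k)^{\mathrm T}y^k=0\ \forall i\in I^k_1\}$; $B^k\in\mathbb R^{n_k\times(n_k-|I^k_1|)}$ is a matrix whose columns form a basis of $M^k$ (when the LICQ holds). SCSC (strict complementary slackness condition) for player $k$: $I^k_2=\emptyset$. LICQ for player $k$ at $(\bar p^k,\bar x^k)$: the vectors $\nabla_{x^k}g^k_i(\bar x^k;\bar w^k)$, $i\in I^k_1\cup I^k_2$, are linearly independent. SOSC (second-order sufficient condition) for player $k$ at $(\bar p^k,\bar x^k,\bar\lambda^k)$: $(y^k)^{\mathrm T}\nabla^2_{x^kx^k}L^ky^k>0$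 for all $y^k\neq0$ in the critical cone $\{y^k\in\mathbb R^{n_k}:\nabla_{x^k}g^k_i(\bar x^k;\bar w^k)^{\mathrm T}y^k=0\ \forall i\in I^k_1,\ \nabla_{x^k}g^k_i(\bar x^k;\bar w^k)^{\mathrm T}y^k\le0\ \forall i\in I^k_2\}$. A set-valued mapping $\Phi$ has a continuously differentiable single-valued localization around $\bar a$ for $\bar b$ if $\bar b\in\Phi(\bar a)$ and there are neighborhoods $U$ of $\bar a$, $V$ of $\bar b$ such that ${\rm gph}\,\Phi\cap(U\times V)$ is the graph of a continuously differentiable single-valued mapping $U\to V$. *)

(* Defs.v *)
From HB Require Import structures.
From mathcomp Require Export all_boot all_order all_algebra.
From mathcomp Require Export all_classical all_reals all_analysis.
Set Implicit Arguments.
Unset Strict Implicit.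
Unset Printing Implicit Defensive.
Export Order.TTheory GRing.Theory Num.Theory numFieldNormedType.Exports.
#[export] Set Implicit Arguments.
#[export] Unset Strict Implicit.
#[export] Unset Printing Implicit Defensive.
#[global] Open Scope classical_set_scope.
#[global] Open Scope ring_scope.

(* Only used for finite-dimensional V, where continuity of every directional
   derivative is the same as continuity of the Frechet derivative. *)
Definition C1_on (R : realType) (V W : normedModType R) (U : set V)
    (h : V -> W) : Prop :=
  forall x, U x ->
    differentiable h x /\ (forall v : V, {for x, continuous ('D_v h)}).

Definition C2 (R : realType) (V W : normedModType R) (h : V -> W) : Prop :=
  C1_on setT h /\ (forall v : V, C1_on setT ('D_v h)).

Definition local_minimizer (R : realType) (V : normedModType R) (F : set V)
    (h : V -> R) (x : V) : Prop :=
  F x /\ \forall y \near x, F y -> h x <= h y.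

(* U is taken open so that differentiability on U makes sense at each of its
   points; shrinking a neighborhood U to its interior loses nothing. *)
Definition C1_localization (R : realType) (A B : normedModType R)
    (Phi : A -> set B) (a : A) (b : B) : Prop :=
  Phi a b /\
  exists (U : set A) (V : set B) (s : A -> B),
    [/\ open_nbhs a U, nbhs b V,
        forall x, U x -> V (s x),
        forall x y, U x -> V y -> (Phi x y <-> y = s x)
      & C1_on U s].

Definition dot (R : realType) (n : nat) (x y : 'cV[R]_n) : R := (x^T *m y) 0 0.

(* The first [numeq k] constraints of player k are equalities, the remaining ones
   are inequalities. *)
Record nep (R : realType) := Nep {
  nplayers : nat;
  dimx : 'I_nplayers -> nat;
  dimg : 'I_nplayers -> nat;
  dimw : 'I_nplayers -> nat;
  numeq : 'I_nplayers -> nat;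
  numeq_le : forall k, (numeq k <= dimg k)%N;
  obj : forall k, 'cV[R]_(\sum_j dimx j)%N * 'cV[R]_(dimw k) -> R;
  con : forall k, 'I_(dimg k) -> 'cV[R]_(dimx k) * 'cV[R]_(dimw k) -> R }.

Section NEP.
Variables (R : realType) (G : nep R).
Local Notation player := 'I_(nplayers G).

Definition strategy : normedModType R := 'cV[R]_(\sum_(j < nplayers G) dimx j)%N.
Definition multiplier : normedModType R :=
  'cV[R]_(\sum_(j < nplayers G) dimg j)%N.
(* p = (u, v, w) *)
Definition param : normedModType R :=
  ('cV[R]_(\sum_(j < nplayers G) dimg j)%N *
   'cV[R]_(\sum_(j < nplayers G) dimx j)%N *
   'cV[R]_(\sum_(j < nplayers G) dimw j)%N)%type.

Implicit Types (p : param) (x : strategy) (lam : multiplier) (k : player).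

Definition xk x k : 'cV[R]_(dimx k) := submxcol x k.
Definition lamk lam k : 'cV[R]_(dimg k) := submxcol lam k.
Definition uk p k : 'cV[R]_(dimg k) := submxcol p.1.1 k.
Definition vk p k : 'cV[R]_(dimx k) := submxcol p.1.2 k.
Definition wk p k : 'cV[R]_(dimw k) := submxcol p.2 k.

(* (y, x^{-k}) *)
Definition deviate x k (y : 'cV[R]_(dimx k)) : strategy :=
  \mxcol_j eqtype.dfwith (fun j => xk x j) y j.

Definition feasible p k (y : 'cV[R]_(dimx k)) : Prop :=
  (forall i : 'I_(dimg k), (i < numeq k)%N -> con i (y, wk p k) = uk p k i 0) /\
  (forall i : 'I_(dimg k), (numeq k <= i)%N -> con i (y, wk p k) <= uk p k i 0).

Definition LNE p x : Prop :=
  forall k, local_minimizer (@feasible p k)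
    (fun y => obj (deviate x y, wk p k) - dot (vk p k) y) (xk x k).

Definition lagrangian k (l : 'cV[R]_(dimg k)) (w : 'cV[R]_(dimw k)) x : R :=
  obj (x, w) + \sum_(i < dimg k) l i 0 * con i (xk x k, w).

(* Partial derivative with respect to the a-th coordinate of x^k. *)
Definition partial k (a : 'I_(dimx k)) (h : strategy -> R) (x : strategy) : R :=
  'D_(delta_mx (tagnat.Rank k a) 0 : strategy) h x.

Definition grad_lagrangian p x lam k : 'cV[R]_(dimx k) :=
  \col_a partial a (lagrangian (lamk lam k) (wk p k)) x.

(* The n_k x n_i matrix of second partials of L^k in (x^k, x^i). *)
Definition hess_lagrangian p x lam k (i : player) : 'M[R]_(dimx k, dimx i) :=
  \matrix_(a, b)
    partial a (partial b (lagrangian (lamk lam k) (wk p k))) x.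

Definition grad_con p x k (i : 'I_(dimg k)) : 'cV[R]_(dimx k) :=
  \col_a 'D_(delta_mx a 0) (fun y : 'cV[R]_(dimx k) => con i (y, wk p k)) (xk x k).

Definition SKKT p : set (strategy * multiplier)%type := fun z =>
  let: (x, lam) := z in
  forall k,
    [/\ vk p k = grad_lagrangian p x lam k,
        forall i : 'I_(dimg k), (i < numeq k)%N ->
          con i (xk x k, wk p k) = uk p k i 0
      & forall i : 'I_(dimg k), (numeq k <= i)%N ->
          [/\ 0 <= lamk lam k i 0,
              con i (xk x k, wk p k) <= uk p k i 0
            & lamk lam k i 0 * (con i (xk x k, wk p k) - uk p k i 0) = 0]].

Definition I1 p x lam k : {set 'I_(dimg k)} :=
  [set i : 'I_(dimg k) | (i < numeq k)%N ||
     [&& (numeq k <= i)%N, 0 < lamk lam k i 0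
       & con i (xk x k, wk p k) - uk p k i 0 == 0]]%SET.

Definition I2 p x lam k : {set 'I_(dimg k)} :=
  [set i : 'I_(dimg k) | [&& (numeq k <= i)%N, lamk lam k i 0 == 0
       & con i (xk x k, wk p k) - uk p k i 0 == 0]]%SET.

Definition SCSC p x lam k : Prop := I2 p x lam k = finset.set0.

Definition LICQ p x lam k : Prop :=
  free [seq grad_con p x i | i in (I1 p x lam k :|: I2 p x lam k)%SET].

Definition Mspace p x lam k : set 'cV[R]_(dimx k) :=
  fun y => forall i, i \in I1 p x lam k -> dot (grad_con p x i) y = 0.

Definition critical_cone p x lam k : set 'cV[R]_(dimx k) :=
  fun y =>
    (forall i, i \in I1 p x lam k -> dot (grad_con p x i) y = 0) /\
    (forall i, i \in I2 p x lam k -> dot (grad_con p x i) y <= 0).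

Definition SOSC p x lam k : Prop :=
  forall y : 'cV[R]_(dimx k), y != 0 -> critical_cone p x lam y ->
    0 < dot y (hess_lagrangian p x lam k k *m y).

Definition columns_basis_of_M p x lam k (q : nat) (B : 'M[R]_(dimx k, q)) : Prop :=
  free [seq col j B | j : 'I_q] /\
  forall y : 'cV[R]_(dimx k),
    y \in <<[seq col j B | j : 'I_q]>>%VS <-> Mspace p x lam y.

Definition Amx p x lam k (i : player) : 'M[R]_(dimx k, dimx i) :=
  hess_lagrangian p x lam k i + (hess_lagrangian p x lam i k)^T.

End NEP.

(* Main.v *)
(** Strict complementarity freezes the active set, so that near the reference
    point the KKT system is a square system of C1 equations in [(x, lambda)],
    and the implicit function theorem applies once the partial Jacobian is
    injective.  If [(y, m)] is in its kernel, then each [y^k] is in [M^k], the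
    constraint terms drop out, and [sum_(k,i) <y^k, H_ki y^i> = 0].  Splitting
    each diagonal term with the weights [alpha] writes this form as a sum over
    pairs [{i, k}] of [alpha_ik <y^i, H_ii y^i> + alpha_ki <y^k, H_kk y^k> +
    <y^i, A_ik y^k>]; minimizing over [y^i] in [M^i] leaves the expression in
    (iv), so [y = 0], and LICQ gives [m = 0].

    For local optimality, SOSC and Finsler's lemma make the Hessian of an
    augmented Lagrangian positive definite at the reference point, hence in a
    whole neighborhood; there each KKT point minimizes the augmented Lagrangian
    locally, and on feasible points the latter is at most the objective. *)

From HB Require Import structures.
Require Import Defs.
From mathcomp Require Import ring lra.

(** The subspace [M^k] moves with the point, so positivity of the Hessian on it is not visibly an
    open condition. Adding the squared slacks of all strongly active constraints, inequalities
    included, moves the positivity to the whole space, where compactness of the unit sphere makes it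
    open, jointly in parameters, strategies and multipliers.

    The same need for uniformity explains why everything lives on the product space of triples
    [(p, (x, lambda))]: there [lag] and [slack] are single C2 functions, and gradients, Hessian
    blocks and constraint gradients are all directional derivatives of them.

    Smoothness is expressed by directional derivatives. Linearity in the direction comes from
    Frechet differentiability, and symmetry of mixed derivatives from second differences.

    In the implicit function theorem the parameters range over any normed space and only the unknown
    is finite-dimensional. Normalizing the partial Jacobian to the identity reduces all estimates to
    a perturbation of norm at most 1/2, and a zero comes from minimization over a compact ball
    rather than from an iteration. *)

Section Reals.
Variable R : realType.
Implicit Types V W : normedModType R.

(** * Directional derivatives and the topology of column spaces *)

Lemma derive_comp_affine (U V W : normedModType R) (f : V -> W) (L : U -> V) x v u :
  (forall h : R, L (h *: v + x) = h *: u + L x) ->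
  'D_v (f \o L) x = 'D_u f (L x).
Proof.
(* The two difference quotients agree term by term, so [f] need not be differentiable. *)
move=> H; rewrite /derive.
by under [in LHS]eq_fun do rewrite /= H.
Qed.

Lemma derive_linear V W (L : V -> W) v x : linear L -> 'D_v L x = L v.
Proof.
move=> linL; rewrite -[L in LHS]/(id \o L) (@derive_comp_affine _ _ _ _ _ _ _ (L v)).
  by rewrite derive_id.
by move=> h; rewrite linL.
Qed.

Lemma differentiable_linear V W (L : V -> W) x :
  linear L -> continuous L -> differentiable L x.
Proof.
move=> linL cL; pose f : {linear V -> W} := HB.pack L (GRing.isLinear.Build _ _ _ _ L linL).
exact: (@linear_differentiable _ _ _ f).
Qed.

Lemma mx_norm_le m n (M : 'M[R]_(m, n)) (e : R) : 0 <= e ->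
  (`|M| <= e) <-> (forall i j, `|M i j| <= e).
Proof.
move=> e0; rewrite [`|M|]/Num.Def.normr/= mx_normrE; split=> [h i j|h].
  apply: le_trans h; exact: (le_bigmax _ (fun ij : 'I_m * 'I_n => `|M ij.1 ij.2|) (i, j)).
by apply: bigmax_le => // -[i j] _ /=.
Qed.

Lemma mx_norm_entry m n (M : 'M[R]_(m, n)) i j : `|M i j| <= `|M|.
Proof. by have [h _] := mx_norm_le M (normr_ge0 M); exact: h. Qed.

Lemma cV_norm_le n (y : 'cV[R]_n) (e : R) : 0 <= e ->
  (forall i, `|y i 0| <= e) -> `|y| <= e.
Proof. by move=> e0 h; apply/mx_norm_le => // i j; rewrite ord1. Qed.

Lemma cV_sum_delta n (y : 'cV[R]_n) : y = \sum_i y i 0 *: delta_mx i 0.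
Proof.
rewrite [LHS]matrix_sum_delta; apply: eq_bigr => i _.
by rewrite big_ord1.
Qed.

Lemma delta_cVE m (a i : 'I_m) : (delta_mx a 0 : 'cV[R]_m) i 0 = (i == a)%:R.
Proof. by rewrite mxE eqxx andbT. Qed.

Lemma derive_dirZ V W (f : V -> W) x a u : differentiable f x ->
  'D_(a *: u) f x = a *: 'D_u f x.
Proof. by move=> df; rewrite !deriveE// linearZ. Qed.

Lemma derive_dirD V W (f : V -> W) x u v : differentiable f x ->
  'D_(u + v) f x = 'D_u f x + 'D_v f x.
Proof. by move=> df; rewrite !deriveE// linearD. Qed.

Lemma derive_dir_sum V W (f : V -> W) x (I : finType) (u : I -> V) :
  differentiable f x -> 'D_(\sum_i u i) f x = \sum_i 'D_(u i) f x.
Proof.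
move=> df; rewrite deriveE// linear_sum; apply: eq_bigr => i _.
by rewrite deriveE.
Qed.

Lemma derive_dir_delta V W n (f : V -> W) (e : 'cV[R]_n -> V) q d :
  differentiable f q -> linear e ->
  'D_(e d) f q = \sum_i d i 0 *: 'D_(e (delta_mx i 0)) f q.
Proof.
move=> df line; pose e' : {linear 'cV[R]_n -> V} :=
  HB.pack e (GRing.isLinear.Build _ _ _ _ e line).
have -> : e d = \sum_i d i 0 *: e (delta_mx i 0).
  rewrite -[LHS]/(e' d) {1}(cV_sum_delta d) linear_sum.
  by apply: eq_bigr => i _; rewrite linearZ.
by rewrite derive_dir_sum//; apply: eq_bigr => i _; rewrite derive_dirZ.
Qed.

Lemma cvg_sum (T I : Type) (F : set_system T) (FF : Filter F) W (r : seq I)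
    (P : pred I) (f : I -> T -> W) (a : I -> W) :
  (forall i, P i -> f i x @[x --> F] --> a i) ->
  \sum_(i <- r | P i) f i x @[x --> F] --> \sum_(i <- r | P i) a i.
Proof.
move=> h; elim: r => [|i r IH].
  rewrite big_nil (_ : (fun _ => _) = fun=> 0); first exact: cvg_cst.
  by apply: funext => x; rewrite big_nil.
rewrite big_cons; under eq_fun do rewrite big_cons.
by case: ifP => // Pi; apply: cvgD => //; exact: h.
Qed.

Lemma linear_continuous_mx m n W (L : 'M[R]_(m, n) -> W) :
  linear L -> continuous L.
Proof.
move=> linL; pose f : {linear 'M[R]_(m, n) -> W} :=
  HB.pack L (GRing.isLinear.Build _ _ _ _ L linL).
rewrite (_ : L = fun M => \sum_i \sum_j M i j *: f (delta_mx i j)); last first.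
  apply: funext => M; rewrite -[LHS]/(f M) [in LHS](matrix_sum_delta M).
  rewrite linear_sum; apply: eq_bigr => i _.
  by rewrite linear_sum; apply: eq_bigr => j _; rewrite linearZ.
move=> M; apply: (@cvg_sum _ _ (nbhs M)) => i _; apply: (@cvg_sum _ _ (nbhs M)) => j _.
by apply: cvgZr_tmp; exact: coord_continuous.
Qed.

Lemma continuous_pair (T T1 T2 : topologicalType) (f : T -> T1) (g : T -> T2) (x : T) :
  {for x, continuous f} -> {for x, continuous g} ->
  {for x, continuous (fun y => (f y, g y))}.
Proof. by move=> cf cg; apply: cvg_pair; [exact: cf|exact: cg]. Qed.

(** Transposition carries the Heine-Borel property from row vectors to columns. *)
Lemma bounded_closed_compact_cV n (A : set 'cV[R]_n) :
  bounded_set A -> closed A -> compact A.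
Proof.
move=> bA cA.
have ctr p q : continuous (trmx : 'M[R]_(p, q) -> 'M[R]_(q, p)).
  by apply: linear_continuous_mx; exact: linearP.
rewrite (_ : A = trmx @` (trmx @^-1` A : set 'rV[R]_n)); last first.
  apply/seteqP; split=> [y Ay|_ [y Ay <-]]//.
  by exists y^T; rewrite /= trmxK.
apply: continuous_compact; first exact/continuous_subspaceT/ctr.
apply: bounded_closed_compact; last by apply: closed_comp => // y _; exact: ctr.
have [M [Mr HM]] := bA; exists M; split=> // N MN y Ay.
have := HM N MN _ Ay; rewrite /= => h.
have N0 : 0 <= N by exact: le_trans h.
apply/mx_norm_le => // i j; have [h' _] := mx_norm_le y^T N0.
by have := h' h j i; rewrite mxE.
Qed.

Definition sphere n : set 'cV[R]_n := [set y | `|y| = 1].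

Lemma compact_sphere n : compact (@sphere n).
Proof.
apply: bounded_closed_compact_cV.
  by exists 1; split => // N N1 y /= ->; exact: ltW.
apply: (@closed_comp _ _ (fun y : 'cV[R]_n => `|y|) [set 1]); last exact: closed_eq.
by move=> y _; exact: norm_continuous.
Qed.

Lemma compact_closed_ball n (z : 'cV[R]_n) (r : R) :
  compact [set y : 'cV[R]_n | `|y - z| <= r].
Proof.
apply: bounded_closed_compact_cV.
  exists (`|z| + r); split; first exact: num_real.
  move=> N N1 y /= yz; apply: le_trans (ltW N1).
  by rewrite -[y](subrK z) addrC (le_trans (ler_normD _ _))// lerD2l.
apply: (@closed_comp _ _ (fun y : 'cV[R]_n => `|y - z|) [set x | x <= r]); last exact: closed_le.
move=> y _; apply: (@continuous_comp _ _ _ (fun y : 'cV[R]_n => y - z) (fun y => `|y|)).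
  by apply: (@continuousB _ _ _ id (cst z)); [move=> ?; exact|exact: cst_continuous].
exact: norm_continuous.
Qed.

(** Tube lemma: each point of [{u0} x K] has a product neighbourhood on which [f] stays positive,
    and compactness of [K] leaves one neighbourhood of [u0]. *)
Lemma near_compact_pos (T U : topologicalType) (K : set T) (f : U -> T -> R) (u0 : U) :
  compact K -> (forall y, K y -> {for (u0, y), continuous (fun q => f q.1 q.2)}) ->
  (forall y, K y -> 0 < f u0 y) ->
  \forall u \near u0, forall y, K y -> 0 < f u y.
Proof.
move=> /compact_near_coveringP cK cf f0.
apply: (cK U (nbhs u0) (fun u y => 0 < f u y)) => y Ky; have := cvgr_gt _ (cf y Ky) _ (f0 y Ky).
case=> -[A B] /= [nA nB] AB; exists (B, A) => //= -[a b] [/= Ba Ab].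
exact: (AB (b, a)).
Qed.

(** Compactness core of Finsler's lemma. Around a zero of [s] in [K], [q] is already positive;
    around other points [s] is bounded away from 0 and a large [r] outweighs [q]. Both persist for
    all larger [r], so compactness gives a common one. *)
Lemma penalty_pos (T : topologicalType) (K : set T) (q s : T -> R) :
  compact K -> continuous q -> continuous s ->
  (forall y, 0 <= s y) -> (forall y, K y -> s y = 0 -> 0 < q y) ->
  exists2 r : R, 0 < r & forall y, K y -> 0 < q y + r * s y.
Proof.
move=> /compact_near_coveringP cK cq cs s0 qs.
have : \forall r \near +oo, K `<=` (fun y => 0 < q y + r * s y).
  apply: (cK R (+oo) (fun r y => 0 < q y + r * s y)) => y Ky.
  have [sy|sy] := eqVneq (s y) 0.
    have := qs y Ky sy => qy.
    exists ([set y | 0 < q y], [set r | 0 <= r]).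
      split => /=; first exact: (cvgr_gt _ (cq y) _ qy).
      exact: nbhs_pinfty_ge.
    by move=> -[a r] [/= qa r0]; rewrite ltr_pwDl// mulr_ge0.
  have sy0 : 0 < s y by rewrite lt_def sy s0.
  have sy2 : s y / 2 < s y by rewrite ltr_pdivrMr// ltr_pMr// ltr1n.
  have qy1 : q y - 1 < q y by rewrite ltrBlDr ltrDl.
  (* On this neighbourhood [q a > q y - 1], while the bound on [r] makes [r * s a] at least
     [1 + |q y|]. *)
  exists ([set a | s y / 2 < s a] `&` [set a | q y - 1 < q a],
    [set r | (1 + `|q y|) / (s y / 2) <= r]).
    split => /=; last exact/nbhs_pinfty_ge/num_real.
    apply: filterI; first exact: (cvgr_gt _ (cs y) _ sy2).
    exact: (cvgr_gt _ (cq y) _ qy1).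
  move=> -[a r] [/= [sa qa]]; rewrite ler_pdivrMr ?divr_gt0// => ra.
  have r0 : 0 <= r.
    rewrite -(@pmulr_lge0 _ (s y / 2)) ?divr_gt0//; apply: le_trans ra.
    by rewrite addr_ge0.
  have : r * (s y / 2) <= r * s a by rewrite ler_wpM2l// ltW.
  have := ler_norm (- q y); rewrite normrN; lra.
case=> M [Mr HM]; exists (Num.max 1 (M + 1)); first by rewrite lt_max ltr01.
by apply: HM; rewrite lt_max ltrDl ltr01 orbT.
Qed.

Lemma near_forall (T : topologicalType) (x : T) (I : finType) (Q : I -> T -> Prop) :
  (forall i, \forall y \near x, Q i y) -> \forall y \near x, forall i, Q i y.
Proof. by move=> H; apply: filter_forall. Qed.

Lemma continuous_cV (T : topologicalType) n (f : T -> 'cV[R]_n) (x : T) :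
  (forall i, {for x, continuous (fun y => f y i 0)}) -> {for x, continuous f}.
Proof.
move=> cf; apply/cvgrPdist_lt => e e0.
have e20 : 0 < e / 2 by rewrite divr_gt0.
have : \forall y \near x, forall i, `|f x i 0 - f y i 0| < e / 2.
  by apply: near_forall => i; move/cvgrPdist_lt: (cf i); apply.
apply: filterS => y H; apply: le_lt_trans (_ : e / 2 < e); last lra.
by apply: cV_norm_le => [|i]; [exact: ltW|rewrite !mxE ltW].
Qed.

Lemma nbhs_norm_lt V (x : V) (r : R) : 0 < r -> nbhs x [set y | `|x - y| < r].
Proof. by move=> r0; apply/nbhs_normP; exists r. Qed.

Lemma near_addr V (x : V) (A : set V) :
  nbhs x A -> \forall h \near (0 : V), A (h + x).
Proof.
move=> /nbhs_normP[d /= d0 Hd]; apply/nbhs_normP; exists d => // h /=.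
by rewrite sub0r normrN => hd; apply: Hd; rewrite /= opprD addrCA subrr addr0 normrN.
Qed.

Lemma near_subr V (x : V) (S : set V) :
  (\forall h \near (0 : V), S h) -> \forall y \near x, S (y - x).
Proof.
move=> /nbhs_normP[d /= d0 Hd]; apply/nbhs_normP; exists d => // y /= xy.
by apply: Hd; rewrite /= sub0r normrN distrC.
Qed.

Lemma continuous_affine (T : topologicalType) (h : T -> R) (a b : R) (x : T) :
  {for x, continuous h} -> {for x, continuous (fun y => a + b * h y)}.
Proof. by move=> ch; apply: cvgD; [exact: cvg_cst|apply: cvgM => //; exact: cvg_cst]. Qed.

Lemma pair_norm_le V W (v : V) (w : W) : `|(v, w)| <= `|v| + `|w|.
Proof. by rewrite prod_normE /= ge_max lerDl lerDr !normr_ge0. Qed.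

Lemma unitmx_of_injective n (A : 'M[R]_n) :
  (forall y : 'cV[R]_n, A *m y = 0 -> y = 0) -> A \in unitmx.
Proof.
move=> inj; rewrite -unitmx_tr -row_free_unit; apply: inj_row_free => v vA.
apply: trmx_inj; rewrite trmx0; apply: inj.
by apply: trmx_inj; rewrite trmx_mul trmxK trmx0.
Qed.

(** * Differentiability and the calculus of C1 and C2 functions *)

Lemma differentiable_eps V W (f : V -> W) (x : V) (e : R) :
  differentiable f x -> 0 < e ->
  \forall k \near 0, `|f (k + x) - f x - 'D_k f x| <= e * `|k|.
Proof.
move=> df e0; have /eqaddoP/(_ e e0) := diff_locally df.
apply: filterS => k /=.
by rewrite deriveE// opprD addrA.
Qed.

Lemma differentiable_of_eps V W (f df : V -> W) (x : V) :
  linear df -> continuous df ->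
  (forall e : R, 0 < e -> \forall h \near 0, `|f (h + x) - f x - df h| <= e * `|h|) ->
  differentiable f x /\ forall v, 'D_v f x = df v.
Proof.
move=> lin cont H; pose g : {linear V -> W} :=
  HB.pack df (GRing.isLinear.Build _ _ _ _ df lin).
have Hg : f \o shift x = cst (f x) + g +o_ 0 id.
  apply/eqaddoP => e e0; have := H e e0; apply: filterS => h /=.
  by rewrite [X in _ -> is_true (`|X| <= _)](_ : _ = f (h + x) - f x - df h)//
    -[RHS]addrA -opprD.
have E : 'd f x = g :> (V -> W) by exact: diff_unique.
have d : differentiable f x by apply/diff_locallyP; rewrite E.
by split=> // v; rewrite deriveE// E.
Qed.

Lemma C1_differentiable V W (f : V -> W) x : C1_on setT f -> differentiable f x.
Proof. by move=> /(_ x I)[]. Qed.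

Lemma C1_continuousD V W (f : V -> W) v : C1_on setT f -> continuous ('D_v f).
Proof. by move=> h x; have [_] := h x I; apply. Qed.

Lemma C1_continuous V W (f : V -> W) : C1_on setT f -> continuous f.
Proof. by move=> h x; apply/differentiable_continuous/C1_differentiable. Qed.

Lemma C1D V W (f g : V -> W) : C1_on setT f -> C1_on setT g ->
  C1_on setT (f \+ g).
Proof.
move=> cf cg x _; split; first exact: (differentiableD (C1_differentiable x cf) (C1_differentiable x cg)).
move=> v; rewrite (_ : 'D_v _ = 'D_v f \+ 'D_v g); last first.
  by apply: funext => y /=; rewrite deriveD//; exact/diff_derivable/C1_differentiable.
by apply: continuousD; exact: C1_continuousD.
Qed.

Lemma C1_cst V W (c : W) : C1_on setT (fun _ : V => c).
Proof.
move=> x _; split=> [|v]; first exact: differentiable_cst.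
rewrite (_ : 'D_v _ = cst 0); last by apply: funext => y; exact: derive_cst.
exact: cvg_cst.
Qed.

Lemma C1_sum V W (I : Type) (r : seq I) (P : pred I) (f : I -> V -> W) :
  (forall i, P i -> C1_on setT (f i)) ->
  C1_on setT (fun x => \sum_(i <- r | P i) f i x).
Proof.
move=> h; elim: r => [|i r IH].
  by rewrite (_ : (fun _ => _) = fun=> 0);
    [exact: C1_cst|apply: funext => x; rewrite big_nil].
case: (boolP (P i)) => Pi.
  rewrite (_ : (fun _ => _) = f i \+ fun x => \sum_(i <- r | P i) f i x).
    by apply: C1D => //; exact: h.
  by apply: funext => x; rewrite big_cons Pi.
rewrite (_ : (fun _ => _) = fun x => \sum_(i <- r | P i) f i x)//.
by apply: funext => x; rewrite big_cons (negPf Pi).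
Qed.

Lemma derive_mul V (f g : V -> R) v x : C1_on setT f -> C1_on setT g ->
  'D_v (f \* g) x = f x * 'D_v g x + g x * 'D_v f x.
Proof.
move=> cf cg; apply: (@deriveM _ _ f g); apply: diff_derivable.
  exact: (C1_differentiable x cf).
exact: (C1_differentiable x cg).
Qed.

Lemma C1M V (f g : V -> R) : C1_on setT f -> C1_on setT g ->
  C1_on setT (f \* g).
Proof.
move=> cf cg x _; split; first exact: (differentiableM (C1_differentiable x cf) (C1_differentiable x cg)).
move=> v; rewrite (_ : 'D_v _ = f \* 'D_v g \+ g \* 'D_v f); last first.
  by apply: funext => y /=; rewrite derive_mul.
have c3 := C1_continuousD (v := v) cf; have c4 := C1_continuousD (v := v) cg.
have m1 : {for x, continuous (f \* 'D_v g)}.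
  by apply: continuousM; [exact: C1_continuous cf x|exact: c4].
have m2 : {for x, continuous (g \* 'D_v f)}.
  by apply: continuousM; [exact: C1_continuous cg x|exact: c3].
exact: (continuousD m1 m2).
Qed.

Lemma C1_linear V W (L : V -> W) : linear L -> continuous L -> C1_on setT L.
Proof.
move=> linL cL x _; split; first exact: differentiable_linear.
move=> v; rewrite (_ : 'D_v L = cst (L v)); first exact: cvg_cst.
by apply: funext => y; rewrite (derive_linear _ _ linL).
Qed.

Lemma C1_comp_linear (U V W : normedModType R) (f : V -> W) (L : U -> V) :
  linear L -> continuous L -> C1_on setT f -> C1_on setT (f \o L).
Proof.
move=> linL cL cf x _; split.
  apply: differentiable_comp; first exact: differentiable_linear.
  exact: C1_differentiable.
move=> v; rewrite (_ : 'D_v _ = 'D_(L v) f \o L); last first.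
  by apply: funext => y /=; apply: derive_comp_affine => h; rewrite linL.
by apply: continuous_comp; [exact: cL|exact: C1_continuousD].
Qed.

Lemma C2_C1 V W (f : V -> W) : C2 f -> C1_on setT f.
Proof. by case. Qed.

Lemma C2D V W (f g : V -> W) : C2 f -> C2 g -> C2 (f \+ g).
Proof.
move=> [f1 f2] [g1 g2]; split; first exact: C1D.
move=> v; rewrite (_ : 'D_v _ = 'D_v f \+ 'D_v g); first exact: C1D.
by apply: funext => y /=; rewrite deriveD//; exact/diff_derivable/C1_differentiable.
Qed.

Lemma C2M V (f g : V -> R) : C2 f -> C2 g -> C2 (f \* g).
Proof.
move=> [f1 f2] [g1 g2]; split; first exact: C1M.
move=> v; rewrite (_ : 'D_v _ = f \* 'D_v g \+ g \* 'D_v f).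
  exact: (C1D (C1M f1 (g2 v)) (C1M g1 (f2 v))).
by apply: funext => y /=; rewrite derive_mul.
Qed.

Lemma C2_cst V W (c : W) : C2 (fun _ : V => c).
Proof.
split; first exact: C1_cst.
move=> v; rewrite (_ : 'D_v _ = cst 0); first exact: C1_cst.
by apply: funext => y; exact: derive_cst.
Qed.

Lemma C2N V (f : V -> R) : C2 f -> C2 (fun x => - f x).
Proof.
move=> f2; rewrite (_ : (fun _ => _) = (fun=> -1) \* f); first exact: (C2M (C2_cst _ _) f2).
by apply: funext => x /=; rewrite mulN1r.
Qed.

Lemma C2_sum V W (I : Type) (r : seq I) (P : pred I) (f : I -> V -> W) :
  (forall i, P i -> C2 (f i)) ->
  C2 (fun x => \sum_(i <- r | P i) f i x).
Proof.
move=> h; elim: r => [|i r IH].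
  by rewrite (_ : (fun _ => _) = fun=> 0);
    [exact: C2_cst|apply: funext => x; rewrite big_nil].
case: (boolP (P i)) => Pi.
  rewrite (_ : (fun _ => _) = f i \+ fun x => \sum_(i <- r | P i) f i x).
    exact: (C2D (h _ Pi) IH).
  by apply: funext => x; rewrite big_cons Pi.
rewrite (_ : (fun _ => _) = fun x => \sum_(i <- r | P i) f i x)//.
by apply: funext => x; rewrite big_cons (negPf Pi).
Qed.

Lemma C2_comp_linear (U V W : normedModType R) (f : V -> W) (L : U -> V) :
  linear L -> continuous L -> C2 f -> C2 (f \o L).
Proof.
move=> linL cL [f1 f2]; split; first exact: C1_comp_linear.
move=> v; rewrite (_ : 'D_v _ = 'D_(L v) f \o L); first exact: C1_comp_linear.
by apply: funext => y /=; apply: derive_comp_affine => h; rewrite linL.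
Qed.

Lemma C2_linear V W (L : V -> W) : linear L -> continuous L -> C2 L.
Proof.
move=> linL cL; split; first exact: C1_linear.
move=> v; rewrite (_ : 'D_v L = cst (L v)); first exact: C1_cst.
by apply: funext => y; rewrite (derive_linear _ _ linL).
Qed.

Lemma derive_fun_sum V W (I : Type) (r : seq I) (P : pred I) (f : I -> V -> W) v x :
  (forall i, P i -> C1_on setT (f i)) ->
  'D_v (fun x => \sum_(i <- r | P i) f i x) x = \sum_(i <- r | P i) 'D_v (f i) x.
Proof.
move=> h; elim: r => [|i r IH].
  rewrite big_nil (_ : (fun _ => _) = cst 0); first exact: derive_cst.
  by apply: funext => y; rewrite big_nil.
rewrite big_cons; case: (boolP (P i)) => Pi.
  rewrite (_ : (fun _ => _) = f i \+ fun x => \sum_(i <- r | P i) f i x).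
    rewrite deriveD ?IH//; apply: diff_derivable.
      exact: (C1_differentiable _ (h _ Pi)).
    exact: (C1_differentiable _ (C1_sum _ h)).
  by apply: funext => y; rewrite big_cons Pi.
rewrite (_ : (fun _ => _) = fun x => \sum_(i <- r | P i) f i x)//.
by apply: funext => y; rewrite big_cons (negPf Pi).
Qed.

Lemma derive_scale V (c : R) (f : V -> R) v x : C1_on setT f ->
  'D_v (fun x => c * f x) x = c * 'D_v f x.
Proof.
move=> cf; rewrite (_ : (fun _ => _) = (fun=> c) \* f)//.
by rewrite (derive_mul _ _ (C1_cst c) cf) derive_cst mulr0 addr0.
Qed.

Lemma derive_add_affine V W (f L : V -> W) (c : W) v x :
  differentiable f x -> linear L -> continuous L ->
  'D_v (fun y => f y + L y + c) x = 'D_v f x + L v.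
Proof.
move=> df linL cL.
have dL := diff_derivable (v := v) (differentiable_linear x linL cL).
have df' := diff_derivable (v := v) df.
rewrite (_ : (fun _ => _) = f \+ L \+ cst c)//.
rewrite (deriveD (derivableD df' dL) (derivable_cst c x v)) derive_cst addr0.
by rewrite (deriveD df' dL) (derive_linear v x linL).
Qed.

(** The terms with the second derivative of [s] carry the factor [s q = 0]. *)
Lemma second_derivative_sqr V (s : V -> R) v q : C2 s -> s q = 0 ->
  'D_v ('D_v (s \* s)) q = 2 * 'D_v s q ^+ 2.
Proof.
move=> [s1 s2] sq.
rewrite (_ : 'D_v (s \* s) = (s \* 'D_v s) \+ (s \* 'D_v s)); last first.
  by apply: funext => x; rewrite derive_mul.
have d : derivable (s \* 'D_v s) q v.
  exact: (diff_derivable (C1_differentiable q (C1M s1 (s2 v)))).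
by rewrite (deriveD d d) (derive_mul v q s1 (s2 v)) sq mul0r add0r expr2 mulr2n mulrDl mul1r.
Qed.

(** * Continuous linear maps *)

Definition contlin V W (L : V -> W) := linear L /\ continuous L.

Lemma contlin_comp (U V W : normedModType R) (g : V -> W) (f : U -> V) :
  contlin f -> contlin g -> contlin (fun x => g (f x)).
Proof.
move=> [lf cf] [lg cg]; split; first by move=> a x y; rewrite lf lg.
by move=> x; apply: continuous_comp; [exact: cf|exact: cg].
Qed.

Lemma contlin_pair (U V W : normedModType R) (f : U -> V) (g : U -> W) :
  contlin f -> contlin g -> contlin (fun x => (f x, g x)).
Proof.
move=> [lf cf] [lg cg]; split; first by move=> a x y; rewrite lf lg.
by move=> x; apply: continuous_pair; [exact: cf|exact: cg].
Qed.

Lemma contlin_fst V W : contlin (fst : V * W -> V).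
Proof. by split => // x; exact: cvg_fst. Qed.

Lemma contlin_snd V W : contlin (snd : V * W -> W).
Proof. by split => // x; exact: cvg_snd. Qed.

Lemma contlin_id V : contlin (fun x : V => x).
Proof. by split => // x. Qed.

Lemma contlin0 V W : contlin (fun _ : V => 0 : W).
Proof. by split => [a x y|x]; [rewrite scaler0 addr0|exact: cvg_cst]. Qed.

Lemma contlin_mx m n W (L : 'M[R]_(m, n) -> W) : linear L -> contlin L.
Proof. by move=> lL; split => //; exact: linear_continuous_mx. Qed.

Lemma contlin_coord V m (f : V -> 'cV[R]_m) i : contlin f -> contlin (fun q => f q i 0).
Proof.
move=> cf; have cg : contlin (fun y : 'cV[R]_m => y i 0 : R).
  by apply: contlin_mx => a x y; rewrite !mxE.
exact: (contlin_comp cf cg).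
Qed.

Lemma C2_contlin V W (L : V -> W) : contlin L -> C2 L.
Proof. by case=> linL cL; exact: C2_linear. Qed.

Lemma C2_comp (U V W : normedModType R) (f : V -> W) (L : U -> V) :
  contlin L -> C2 f -> C2 (f \o L).
Proof. by case=> linL cL; exact: C2_comp_linear. Qed.

(** * Mean values and the symmetry of second derivatives *)

Lemma C1_line V W (f : V -> W) (x y : V) (t : R) : C1_on setT f ->
  is_derive t 1 (fun s : R => f (x + s *: y)) ('D_y f (x + t *: y)).
Proof.
move=> cf; split.
  apply: diff_derivable; apply: (@differentiable_comp _ _ _ _ (fun s : R => x + s *: y) f).
    apply: (@differentiableD _ _ _ (cst x) (fun s : R => s *: y)).
      exact: differentiable_cst.
    by apply: differentiable_linear; [move=> a u v; rewrite scalerDl scalerA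
      |exact: scalel_continuous].
  exact: C1_differentiable.
rewrite -[LHS]/('D_1 (f \o (fun s => x + s *: y)) t).
by apply: derive_comp_affine => h; rewrite scalerDl [h%:A]mulr1 addrCA.
Qed.

Lemma mean_value V (f : V -> R) (x y : V) : C1_on setT f ->
  exists2 t : R, t \in `]0, 1[%R & f (x + y) - f x = 'D_y f (x + t *: y).
Proof.
move=> cf; have [s _| |t t01 e] := @MVT R (fun t => f (x + t *: y))
    (fun t => 'D_y f (x + t *: y)) 0 1 ltr01.
- exact: C1_line.
- apply: continuous_subspaceT => s; apply: differentiable_continuous.
  by apply/derivable1_diffP; case: (C1_line x y s cf).
- by exists t => //; move: e; rewrite scale1r scale0r addr0 subr0 mulr1.
Qed.

Lemma C1_shift V W (f : V -> W) (c : V) : C1_on setT f ->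
  C1_on setT (fun y => f (y + c)).
Proof.
move=> cf x _.
have dsh : differentiable (fun y : V => y + c) x.
  apply: (@differentiableD _ _ _ id (cst c)); last exact: differentiable_cst.
  by apply: differentiable_linear => // y.
split.
  exact: (@differentiable_comp _ _ _ _ (fun y => y + c) f _ dsh (C1_differentiable _ cf)).
move=> v; rewrite (_ : 'D_v _ = 'D_v f \o (fun y => y + c)); last first.
  apply: funext => y /=; rewrite -[LHS]/('D_v (f \o (fun y => y + c)) y).
  by apply: derive_comp_affine => h; rewrite addrA.
apply: continuous_comp; last exact: C1_continuousD.
exact: differentiable_continuous dsh.
Qed.

(** The mean value theorem is applied along [u] to the increment [h (y + s *: v) - h y], then along
    [v] to ['D_u h]. The left side is symmetric in [u] and [v] while the right side is not: this is
    the source of [Schwarz]. *)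
Lemma second_difference V (h : V -> R) (x u v : V) (s : R) : C2 h ->
  exists t t' : R, [/\ t \in `]0, 1[, t' \in `]0, 1[ &
    h (x + s *: u + s *: v) - h (x + s *: u) - (h (x + s *: v) - h x) =
    s * s * 'D_v ('D_u h) (x + (t * s) *: u + (t' * s) *: v)].
Proof.
move=> [h1 h2].
pose g y := h (y + s *: v) - h y.
have gD y w : 'D_w g y = 'D_w h (y + s *: v) - 'D_w h y.
  rewrite /g (@deriveB _ _ _ (fun y => h (y + s *: v)) h).
  - congr (_ - _); rewrite -[LHS]/('D_w (h \o (fun y => y + s *: v)) y).
    by apply: derive_comp_affine => k; rewrite addrA.
  - by apply: diff_derivable; have [] := C1_shift (s *: v) h1 (x := y) I.
  - by apply: diff_derivable; have [] := h1 y I.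
have g1 : C1_on setT g.
  move=> y _; split.
    by apply: (@differentiableB _ _ _ (fun y => h (y + s *: v)) h);
      [have [] := C1_shift (s *: v) h1 (x := y) I|have [] := h1 y I].
  move=> w; rewrite (_ : 'D_w g = fun y => 'D_w h (y + s *: v) - 'D_w h y); last first.
    by apply: funext => z; rewrite gD.
  apply: (@continuousB _ _ _ (fun y => 'D_w h (y + s *: v)) ('D_w h)).
    exact: (C1_continuous (C1_shift (s *: v) (h2 w))).
  exact: (C1_continuous (h2 w)).
have [t t01 et] := mean_value x (s *: u) g1.
have [t' t01' et'] := mean_value (x + t *: (s *: u)) (s *: v) (h2 u).
exists t, t'; split => //.
rewrite -[LHS]/(g (x + s *: u) - g x) et derive_dirZ; last by have [] := g1 (x + t *: (s *: u)) I.
rewrite gD et' derive_dirZ; last by have [] := h2 u (x + t *: (s *: u) + t' *: (s *: v)) I.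
by rewrite !scalerA.
Qed.

Lemma continuous_ball V (g : V -> R) (x : V) (e : R) :
  {for x, continuous g} -> 0 < e ->
  exists2 d : R, 0 < d & forall y, `|x - y| < d -> `|g x - g y| < e.
Proof.
move=> /cvgrPdist_lt cg e0; have := cg e e0.
by move=> /nbhs_normP[d /= d0 Hd]; exists d.
Qed.

Lemma eq_of_close (a b : R) :
  (forall e : R, 0 < e -> exists z : R, `|a - z| < e /\ `|b - z| < e) -> a = b.
Proof.
move=> h; apply/eqP; rewrite -subr_eq0; apply: contraT => ab.
have e0 : 0 < `|a - b| / 2 by rewrite divr_gt0// normr_gt0.
have [z [az bz]] := h _ e0.
have := ler_distD z a b; rewrite [`|z - b|]distrC.
by move: az bz; set c := `|a - b|; lra.
Qed.

(** In use [A] and [B] are the two mixed derivatives. Both left sides are the same number, so after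
    division by [s * s] the value of [A] at one point equals that of [B] at another, and both points
    tend to [x] with [s]. *)
Lemma eq_second_differences V (h A B : V -> R) (x u v : V) :
  {for x, continuous A} -> {for x, continuous B} ->
  (forall s : R, exists t t' : R, [/\ t \in `]0, 1[, t' \in `]0, 1[ &
    h (x + s *: v + s *: u) - h (x + s *: v) - (h (x + s *: u) - h x) =
    s * s * A (x + (t * s) *: v + (t' * s) *: u)]) ->
  (forall s : R, exists t t' : R, [/\ t \in `]0, 1[, t' \in `]0, 1[ &
    h (x + s *: u + s *: v) - h (x + s *: u) - (h (x + s *: v) - h x) =
    s * s * B (x + (t * s) *: u + (t' * s) *: v)]) ->
  A x = B x.
Proof.
move=> cA cB SA SB; apply: eq_of_close => e e0.
have [d d0 Hd] : exists2 d : R, 0 < d & forall y, `|x - y| < d ->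
    `|A x - A y| < e /\ `|B x - B y| < e.
  have [d1 d10 H1] := continuous_ball cA e0.
  have [d2 d20 H2] := continuous_ball cB e0.
  exists (Num.min d1 d2); first by rewrite lt_min d10.
  by move=> y; rewrite lt_min => /andP[y1 y2]; split; [exact: H1|exact: H2].
have uv0 : 0 < `|u| + `|v| + 1 by rewrite ltr_wpDl// addr_ge0.
(* This puts the intermediate points within [d / 2] of [x]; the [1] keeps the denominator positive
   when [u = v = 0]. *)
pose s := d / 2 / (`|u| + `|v| + 1).
have s0 : 0 < s by rewrite !divr_gt0.
have Hs (t t' : R) : t \in `]0, 1[ -> t' \in `]0, 1[ ->
    `|x - (x + (t * s) *: u + (t' * s) *: v)| < d.
  rewrite !in_itv /= => /andP[t0 t1] /andP[t0' t1'].
  rewrite -addrA opprD addrA subrr add0r normrN.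
  apply: le_lt_trans (ler_normD _ _) _; rewrite !normrZ !gtr0_norm ?mulr_gt0//.
  apply: (@le_lt_trans _ _ (s * `|u| + s * `|v|)).
    by apply: lerD; rewrite ler_wpM2r// ler_piMl// ltW.
  apply: (@le_lt_trans _ _ (s * (`|u| + `|v| + 1))).
    by rewrite !mulrDr mulr1 lerDl ltW.
  by rewrite /s divfK ?gt_eqF//; lra.
clearbody s.
have [t1 [t1' [t101 t101' E1]]] := SB s.
have [t2 [t2' [t201 t201' E2]]] := SA s.
have E : B (x + (t1 * s) *: u + (t1' * s) *: v) =
         A (x + (t2' * s) *: u + (t2 * s) *: v).
  apply: (@mulfI _ (s * s)); first by rewrite mulf_neq0// gt_eqF.
  rewrite (addrAC x ((t2' * s) *: u)).
  apply: (eq_trans (esym E1)); apply: (eq_trans _ E2).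
  by rewrite (addrAC x (s *: v)) !opprB addrACA [- h (x + s *: u) + _]addrC -addrACA addrA.
have [_ b1] := Hd _ (Hs _ _ t101 t101'); have [b2 _] := Hd _ (Hs _ _ t201' t201).
by exists (A (x + (t2' * s) *: u + (t2 * s) *: v)); split => //; rewrite -E.
Qed.

(* Keeps unification from unfolding the limits behind iterated derivatives. *)
#[local] Opaque derive.

Lemma Schwarz V (h : V -> R) (x u v : V) : C2 h ->
  'D_u ('D_v h) x = 'D_v ('D_u h) x.
Proof.
move=> h2.
apply: (@eq_second_differences V h ('D_u ('D_v h)) ('D_v ('D_u h)) x u v).
- exact: (C1_continuousD (h2.2 v)).
- exact: (C1_continuousD (h2.2 u)).
- by move=> s; exact: second_difference.
- by move=> s; exact: second_difference.
Qed.

(** * Second-order conditions for local minima *)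

Lemma second_derivative_bilinear V n (f : V -> R) (e : 'cV[R]_n -> V) (q : V) (d d' : 'cV[R]_n) :
  C2 f -> linear e ->
  'D_(e d) ('D_(e d') f) q =
  \sum_i \sum_j d i 0 * d' j 0 * 'D_(e (delta_mx i 0)) ('D_(e (delta_mx j 0)) f) q.
Proof.
(* Only the outer direction can be expanded linearly; symmetry brings the inner one outside and
   back. *)
move=> f2 line; rewrite (derive_dir_delta d (C1_differentiable q (f2.2 _)) line).
apply: eq_bigr => i _; rewrite Schwarz//.
rewrite (derive_dir_delta d' (C1_differentiable q (f2.2 _)) line) scaler_sumr.
by apply: eq_bigr => j _; rewrite Schwarz// scalerA.
Qed.

(** In coordinates the form is jointly continuous in point and direction, so [near_compact_pos]
    applies on the unit sphere; homogeneity of degree two covers the other directions. *)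
Lemma second_derivative_pos_near V n (f : V -> R) (e : 'cV[R]_n -> V) (q0 : V) :
  C2 f -> linear e ->
  (forall d, d != 0 -> 0 < 'D_(e d) ('D_(e d) f) q0) ->
  \forall q \near q0, forall d, d != 0 -> 0 < 'D_(e d) ('D_(e d) f) q.
Proof.
move=> f2 line pos.
pose S q (d : 'cV[R]_n) := \sum_i \sum_j d i 0 * d j 0 *
  'D_(e (delta_mx i 0)) ('D_(e (delta_mx j 0)) f) q.
have SE q d : 'D_(e d) ('D_(e d) f) q = S q d by exact: second_derivative_bilinear.
have : \forall q \near q0, forall d, sphere d -> 0 < S q d.
  apply: near_compact_pos; first exact: compact_sphere.
    move=> d _; apply: (@cvg_sum _ _ (nbhs (q0, d))) => i _.
    apply: (@cvg_sum _ _ (nbhs (q0, d))) => j _.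
    have c k : (p.2 : 'cV[R]_n) k 0 @[p --> (q0, d)] --> d k 0.
      apply: (@cvg_comp _ _ _ snd (fun y : 'cV[R]_n => y k 0) _ (nbhs d)).
        exact: cvg_snd.
      exact: coord_continuous.
    apply: cvgM; first by apply: cvgM; exact: c.
    apply: (@cvg_comp _ _ _ fst ('D_(e (delta_mx i 0)) ('D_(e (delta_mx j 0)) f)) _ (nbhs q0)).
      exact: cvg_fst.
    exact: (C1_continuousD (f2.2 _)).
  move=> d; rewrite /sphere /= => d1; rewrite -SE; apply: pos.
  by rewrite -normr_eq0 d1 oner_eq0.
apply: filterS => q Sq d d0; rewrite SE.
have nd : 0 < `|d| by rewrite normr_gt0.
have -> : S q d = `|d| ^+ 2 * S q (`|d|^-1 *: d).
  rewrite /S big_distrr; apply: eq_bigr => i _; rewrite big_distrr.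
  apply: eq_bigr => j _ /=; rewrite !mxE; set D := 'D_ _ _ _.
  by field; rewrite gt_eqF.
rewrite mulr_gt0 ?exprn_gt0//; apply: Sq.
by rewrite /sphere /= normrZ normfV normr_id mulVf// gt_eqF.
Qed.

(** The neighbourhood of [q0] is chosen before [q], hence serves all critical points near [q0]. Two
    uses of the mean value theorem write [f (q + e d) - f q] as a positive multiple of a second
    derivative on the segment from [q] to [q + e d]. *)
Lemma local_min_near V n (f : V -> R) (e : 'cV[R]_n -> V) (q0 : V) :
  C2 f -> linear e ->
  (forall d, d != 0 -> 0 < 'D_(e d) ('D_(e d) f) q0) ->
  \forall q \near q0, (forall d, 'D_(e d) f q = 0) ->
    \forall d \near (0 : 'cV[R]_n), f q <= f (q + e d).
Proof.
move=> f2 line pos; have := second_derivative_pos_near f2 line pos.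
move=> /nbhs_normP[r /= r0 Hr].
(* Half of the radius is spent on [q], the other half on the displacement [e d]. *)
have r20 : 0 < r / 2 by rewrite divr_gt0.
have : \forall q \near q0, `|q0 - q| < r / 2 by apply/nbhs_normP; exists (r / 2).
apply: filterS => q qq0 Dq.
have ce : continuous e by exact: linear_continuous_mx.
have e0 : e 0 = 0 by have := line (-1) 0 0; rewrite scaler0 add0r scaleN1r addNr.
have : \forall d \near (0 : 'cV[R]_n), `|e d| < r / 2.
  have /cvgrPdist_lt/(_ _ r20) := ce 0; rewrite e0.
  by apply: filterS => d; rewrite sub0r normrN.
apply: filterS => d ed.
have [->|d0] := eqVneq d 0; first by rewrite e0 addr0.
rewrite -subr_ge0.
have [t t01 ->] := mean_value q (e d) f2.1.
have -> : 'D_(e d) f (q + t *: e d) = 'D_(e d) f (q + t *: e d) - 'D_(e d) f q.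
  by rewrite Dq subr0.
have [t' t01' ->] := mean_value q (t *: e d) (f2.2 (e d)).
rewrite derive_dirZ; last exact: C1_differentiable (f2.2 _).
move: t01 t01'; rewrite !in_itv /= => /andP[t0 t1] /andP[t0' t1'].
apply: mulr_ge0; first exact: ltW.
apply/ltW/Hr => //.
rewrite /= opprD addrA; apply: le_lt_trans (ler_normB _ _) _.
rewrite (splitr r); apply: ltrD => //.
rewrite scalerA normrZ; apply: le_lt_trans ed.
rewrite ler_piMl// ger0_norm ?mulr_ge0 ?ltW//.
by rewrite mulr_ilt1// ltW.
Qed.

(** * Free families and matrix columns *)

Lemma free_image (I : finType) (V : vectType R) (f : I -> V) (S : {set I}) (mu : I -> R) :
  free [seq f i | i in S] -> \sum_(i in S) mu i *: f i = 0 ->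
  forall i, i \in S -> mu i = 0.
Proof.
move=> frS sum0 i iS.
pose s := enum S; have /freeP fr : free (in_tuple [seq f i | i <- s]) by [].
have si : (index i s < size [seq f i | i <- s])%N by rewrite size_map index_mem mem_enum.
have := fr (fun j => mu (nth i s j)) _ (Ordinal si).
rewrite nth_index ?mem_enum//; apply.
rewrite -[RHS]sum0 -[RHS]big_enum/= -/s [RHS](big_nth i).
rewrite -(big_mkord xpredT (fun j => mu (nth i s j) *: [seq f i | i <- s]`_j)) size_map.
by apply: eq_big_nat => j /andP[_ js]; rewrite (nth_map i).
Qed.

Lemma mulmx_sum_col m n (A : 'M[R]_(m, n)) (z : 'cV[R]_n) :
  A *m z = \sum_j z j 0 *: col j A.
Proof.
apply/colP => i; rewrite mxE summxE; apply: eq_bigr => j _.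
by rewrite !mxE mulrC.
Qed.

Lemma free_cols_inj m n (A : 'M[R]_(m, n)) (z : 'cV[R]_n) :
  free [seq col j A | j : 'I_n] -> A *m z = 0 -> z = 0.
Proof.
move=> fr Az; have /freeP fr' : free [tuple col j A | j < n] by [].
apply/colP => j; rewrite mxE; apply: (fr' (fun j => z j 0)).
rewrite -[RHS]Az mulmx_sum_col; apply: eq_bigr => i _.
by rewrite -tnth_nth tnth_mktuple.
Qed.

Lemma span_cols m n (A : 'M[R]_(m, n)) (y : 'cV[R]_m) :
  y \in <<[seq col j A | j : 'I_n]>>%VS <-> exists z, y = A *m z.
Proof.
split=> [ys|[z ->]].
  have /coord_span -> : y \in <<[tuple col j A | j < n]>>%VS by [].
  exists (\col_i coord [tuple col j A | j < n] i y).
  rewrite mulmx_sum_col; apply: eq_bigr => i _.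
  by rewrite mxE -tnth_nth tnth_mktuple.
rewrite mulmx_sum_col; apply: rpred_sum => j _; apply: rpredZ.
by apply: memv_span; apply/mapP; exists j; rewrite ?mem_enum.
Qed.

(** * An implicit function theorem *)

Section NormalizedImplicit.
Variables (P : normedModType R) (N : nat).
Variables (G : 'I_N -> P * 'cV[R]_N -> R).
Hypothesis G1 : forall i, C1_on setT (G i).

Let g p z : 'cV[R]_N := \col_i G i (p, z).

Let Dg q v : 'cV[R]_N := \col_i 'D_v (G i) q.

Lemma G_diff i q : differentiable (G i) q.
Proof. exact: C1_differentiable. Qed.

Lemma DgD q u v : Dg q (u + v) = Dg q u + Dg q v.
Proof. by apply/colP => i; rewrite !mxE (derive_dirD _ _ (G_diff i q)). Qed.

Lemma DgB q u v : Dg q (u - v) = Dg q u - Dg q v.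
Proof. by apply: (@addIr _ (Dg q v)); rewrite subrK -DgD subrK. Qed.

Lemma DgZ q a u : Dg q (a *: u) = a *: Dg q u.
Proof. by apply/colP => i; rewrite !mxE (derive_dirZ _ _ (G_diff i q)). Qed.

(** In the sup norm the partial Jacobian in [z] is within 1/2 of the identity. The bound is
    coordinatewise because the mean value theorem yields a different intermediate point for each
    coordinate. *)
Definition close_to_id (p : P) (z : 'cV[R]_N) : Prop :=
  forall y i, `|'D_(0, y) (G i) (p, z) - y i 0| <= 2^-1 * `|y|.

Lemma linear_inr : linear (fun y : 'cV[R]_N => (0, y) : P * 'cV[R]_N).
Proof. by move=> a u v; rewrite -[RHS]/(a *: 0 + 0, a *: u + v) scaler0 addr0. Qed.

Lemma near_close_to_id (p0 : P) (z0 : 'cV[R]_N) :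
  (forall i j, 'D_(0, delta_mx j 0) (G i) (p0, z0) = (i == j)%:R) ->
  \forall q \near (p0, z0), close_to_id q.1 q.2.
Proof.
(* A row has [N] entries, each off by less than [e], so its total error stays below 1/2; [N.+1]
   keeps [e] positive for [N = 0]. *)
move=> D0; pose e : R := (2 * N.+1%:R)^-1.
have e0 : 0 < e by rewrite invr_gt0 mulr_gt0// ltr0n.
have : \forall q \near (p0, z0), forall i j : 'I_N,
    `|(i == j)%:R - 'D_(0, delta_mx j 0) (G i) q| < e.
  apply: near_forall => i; apply: near_forall => j.
  have := C1_continuousD (v := (0, delta_mx j 0)) (G1 i).
  by move=> /(_ (p0, z0))/cvgrPdist_lt/(_ e e0); rewrite D0.
apply: filterS => -[p z] /= H y i.
rewrite (derive_dir_delta y (G_diff i (p, z)) linear_inr).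
have -> : y i 0 = \sum_j y j 0 * (i == j)%:R.
  rewrite (bigD1 i)//= eqxx mulr1 big1 ?addr0// => j ji.
  by rewrite eq_sym (negPf ji) mulr0.
rewrite -sumrB; apply: le_trans (ler_norm_sum _ _ _) _.
apply: (@le_trans _ _ (\sum_(j < N) `|y| * e)).
  apply: ler_sum => j _; rewrite -mulrBr normrM ler_pM//; first exact: mx_norm_entry.
  by rewrite distrC ltW.
rewrite sumr_const card_ord -[_ *+ _]mulr_natr.
rewrite [leLHS](_ : _ = 2^-1 * `|y| * (N.+1%:R^-1 * N%:R)); last by rewrite /e invfM; ring.
by rewrite ler_piMr ?mulr_ge0// mulrC ler_pdivrMr ?ltr0n// mul1r ler_nat.
Qed.

Section Ball.
Variables (p : P) (z0 : 'cV[R]_N) (r : R).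
Hypothesis close : forall z : 'cV[R]_N, `|z0 - z| < r -> close_to_id p z.

(** The map [z - g p z] contracts by 1/2: the ball is convex, so [close_to_id] holds at every
    intermediate point. *)
Lemma newton_estimate (z z' : 'cV[R]_N) : `|z0 - z| < r -> `|z0 - z'| < r ->
  `|g p z' - g p z - (z' - z)| <= 2^-1 * `|z' - z|.
Proof.
move=> zr zr'; apply: cV_norm_le => [|i]; first by rewrite mulr_ge0.
rewrite !mxE.
have [t] := mean_value (p, z) (0, z' - z) (G1 i).
rewrite in_itv /= => /andP[t0 t1].
rewrite -[(p, z) + (0, z' - z)]/(p + 0, z + (z' - z)) addr0 subrKC => ->.
have -> : (p, z) + t *: ((0, z' - z) : P * 'cV[R]_N) = (p, z + t *: (z' - z)).
  by congr pair; rewrite /= scaler0 addr0.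
have := @close (z + t *: (z' - z)) _ (z' - z) i; rewrite !mxE; apply.
have -> : z0 - (z + t *: (z' - z)) = (1 - t) *: (z0 - z) + t *: (z0 - z').
  by apply/matrixP => a b; rewrite !mxE; ring.
apply: le_lt_trans (ler_normD _ _) _; rewrite !normrZ !gtr0_norm ?subr_gt0//.
have := ltr_pM2l t0 `|z0 - z'| r; rewrite zr' => h1.
have h2 : (1 - t) * `|z0 - z| < (1 - t) * r by rewrite ltr_pM2l// subr_gt0.
by move: h1 h2; set A := _ * `|z0 - z'|; set B := _ * `|z0 - z|; lra.
Qed.

(** Triangle inequality on [newton_estimate]. It yields uniqueness of zeros and continuity of the
    solution. *)
Lemma expansive_map (z z' : 'cV[R]_N) : `|z0 - z| < r -> `|z0 - z'| < r ->
  `|z' - z| <= 2 * `|g p z' - g p z|.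
Proof.
move=> zr zr'; have := newton_estimate zr zr'; set u := g p z' - g p z; set v := z' - z.
move=> h; have := lerB_dist v u; rewrite distrC.
by move: h; set A := `|u - v|; lra.
Qed.

(** Infinitesimal counterpart of [expansive_map]: the partial Jacobian is invertible throughout the
    ball, with an inverse of norm at most 2. *)
Lemma expansive_lin (z y : 'cV[R]_N) : `|z0 - z| < r -> `|y| <= 2 * `|Dg (p, z) (0, y)|.
Proof.
move=> zr; have h : `|Dg (p, z) (0, y) - y| <= 2^-1 * `|y|.
  by apply: cV_norm_le => [|i]; [rewrite mulr_ge0|rewrite !mxE; exact: close].
have := lerB_dist y (Dg (p, z) (0, y)); rewrite distrC.
by move: h; set A := `|_ - y|; lra.
Qed.

Lemma newton_zero : 0 < r -> `|g p z0| < r / 4 ->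
  exists2 z, `|z - z0| <= r / 2 & g p z = 0.
Proof.
move=> r0 gr.
have gc : continuous (g p).
  move=> z; apply: continuous_cV => i.
  rewrite (_ : (fun _ => _) = (fun y => G i (p, y))); last first.
    by apply: funext => y; rewrite mxE.
  apply: (@continuous_comp _ _ _ (fun z' : 'cV[R]_N => (p, z')) (G i)).
    by apply: continuous_pair; [exact: cst_continuous|move=> ?; exact].
  exact: (C1_continuous (G1 i)).
have [|||c] := @compact_EVT_min _ R (fun z => `|g p z|) [set z | `|z - z0| <= r / 2].
- by exists z0; rewrite /= subrr normr0 divr_ge0// ltW.
- exact: compact_closed_ball.
- apply: continuous_subspaceT => z.
  by apply: continuous_comp; [exact: gc|exact: norm_continuous].
(* A minimizer [c] of [|g p|] over the ball is a zero, since the Newton step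
   from [c] stays in the ball and halves [|g p|]. *)
rewrite inE /= => cr cmin; exists c => //; apply/eqP; apply: contraT => gc0.
have rr : r / 2 < r by lra.
have z0r : `|z0 - z0| < r by rewrite subrr normr0.
have cr' : `|z0 - c| < r by rewrite distrC (le_lt_trans cr).
pose z' := c - g p c.
have zr' : `|z' - z0| <= r / 2.
  have h := newton_estimate z0r cr'.
  have -> : z' - z0 = - (g p c - g p z0 - (c - z0)) - g p z0.
    by apply/matrixP => a b; rewrite !mxE; ring.
  apply: le_trans (ler_normB _ _) _; rewrite normrN.
  by move: h cr gr; set A := `|_ - (_ - _)|; set B := `|_ - _|; lra.
have := cmin z'; rewrite inE /= => /(_ zr').
have := newton_estimate cr' (le_lt_trans (_ : `|z0 - z'| <= r / 2) rr); rewrite distrC => /(_ zr').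
have -> : z' - c = - g p c by rewrite /z' addrAC subrr sub0r.
rewrite opprK subrK normrN.
have : 0 < `|g p c| by rewrite normr_gt0.
lra.
Qed.

End Ball.

(** The threshold [r / 4] keeps Newton steps inside the closed ball of radius [r / 2]: a step at
    most halves the distance to [z0], up to an error [|g p z0|]. *)
Definition implicit_at (p : P) (z0 : 'cV[R]_N) (r : R) : Prop :=
  (forall z : 'cV[R]_N, `|z0 - z| < r -> close_to_id p z) /\ `|g p z0| < r / 4.

Section Solution.
Variables (z0 : 'cV[R]_N) (r : R) (s : P -> 'cV[R]_N) (p : P).
Hypothesis near_p : \forall p' \near p, implicit_at p' z0 r.
Hypothesis s_in : forall p', implicit_at p' z0 r -> `|z0 - s p'| < r.
Hypothesis s_zero : forall p', implicit_at p' z0 r -> g p' (s p') = 0.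

Let imp : implicit_at p z0 r.
Proof. exact: nbhs_singleton near_p. Qed.

Let E (q : P * 'cV[R]_N) : 'M[R]_N := \matrix_(i, j) 'D_(0, delta_mx j 0) (G i) q.

Lemma jacobian_mul q y : E q *m y = Dg q (0, y).
Proof.
apply/colP => i; rewrite !mxE (derive_dir_delta y (G_diff i q) linear_inr).
by apply: eq_bigr => j _; rewrite mxE mulrC.
Qed.

Lemma jacobian_unit : E (p, s p) \in unitmx.
Proof.
apply: unitmx_of_injective => y; rewrite jacobian_mul => Ey.
have := expansive_lin imp.1 y (s_in imp); rewrite Ey normr0 mulr0 normr_le0.
by move/eqP.
Qed.

(** The derivative of [s] predicted by implicit differentiation: minus the inverse of the partial
    Jacobian in [z], applied to the partial derivative in the parameter. *)
Let ds (v : P) : 'cV[R]_N := - (invmx (E (p, s p)) *m Dg (p, s p) (v, 0)).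

Lemma ds_eq v : Dg (p, s p) (v, ds v) = 0.
Proof.
rewrite (_ : (v, ds v) = (v, 0) + (0, ds v)); last first.
  by rewrite -[RHS]/(v + 0, 0 + ds v) addr0 add0r.
by rewrite DgD -jacobian_mul /ds mulmxN mulKVmx ?jacobian_unit// subrr.
Qed.

Lemma ds_linear : linear ds.
Proof.
move=> a u v; rewrite /ds.
rewrite (_ : (a *: u + v, 0) = a *: ((u, 0) : P * 'cV[R]_N) + (v, 0)); last first.
  by rewrite -[RHS]/(a *: u + v, a *: 0 + 0) scaler0 addr0.
by rewrite DgD DgZ mulmxDr -scalemxAr opprD scalerN.
Qed.

Lemma ds_continuous : continuous ds.
Proof.
move=> v; apply: (@continuousN _ _ _ (fun v => invmx (E (p, s p)) *m Dg (p, s p) (v, 0))).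
apply: (@continuous_comp _ _ _ (fun v => Dg (p, s p) (v, 0)) (fun y => invmx (E (p, s p)) *m y)).
  apply: continuous_cV => i.
  rewrite (_ : (fun _ => _) = (fun y => 'd (G i) (p, s p) (y, 0))); last first.
    by apply: funext => y; rewrite mxE deriveE//; exact: G_diff.
  apply: (@continuous_comp _ _ _ (fun y : P => (y, 0 : 'cV[R]_N)) ('d (G i) (p, s p))).
    by apply: continuous_pair; [move=> ?; exact|exact: cst_continuous].
  exact: (diff_continuous (G_diff i (p, s p))).
by apply: linear_continuous_mx => a x y; rewrite mulmxDr -scalemxAr.
Qed.

(** By [expansive_map] at [p'], the distance from [s p'] to [s p] is at most twice [|g p' (s p)|],
    which tends to [|g p (s p)| = 0]. *)
Lemma solution_continuous : {for p, continuous s}.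
Proof.
apply/cvgrPdist_lt => e e0.
have gc : {for p, continuous (fun p' => g p' (s p))}.
  apply: continuous_cV => i.
  rewrite (_ : (fun _ => _) = (fun y => G i (y, s p))); last first.
    by apply: funext => y; rewrite mxE.
  apply: (@continuous_comp _ _ _ (fun y : P => (y, s p)) (G i)).
    by apply: continuous_pair; [move=> ?; exact|exact: cst_continuous].
  exact: (C1_continuous (G1 i)).
have e20 : 0 < e / 2 by rewrite divr_gt0.
have /cvgrPdist_lt/(_ _ e20) := gc; rewrite s_zero//.
apply: filterS2 near_p => p' imp'; rewrite sub0r normrN => h.
have := expansive_map imp'.1 (s_in imp') (s_in imp).
rewrite s_zero// subr0; set A := `|s p - _|; move: h; lra.
Qed.

(** As [G] vanishes at both points of the graph of [s], its linearization along [(h, k)] is itself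
    of the size of the error. It equals the linearization along [(0, k - ds h)], and [expansive_lin]
    bounds [k - ds h]. *)
Lemma solution_expansion (e : R) : 0 < e ->
  \forall h \near (0 : P), `|s (h + p) - s p - ds h| <= 2 * e * (`|h| + `|s (h + p) - s p|).
Proof.
move=> e0.
have : \forall k \near (0 : P * 'cV[R]_N), forall i,
    `|G i (k + (p, s p)) - G i (p, s p) - 'D_k (G i) (p, s p)| <= e * `|k|.
  by apply: near_forall => i; apply: differentiable_eps => //; exact: G_diff.
move=> /nbhs_normP[d /= d0 Hd'].
have Hd (k : P * 'cV[R]_N) : `|k| < d -> forall i,
    `|G i (k + (p, s p)) - G i (p, s p) - 'D_k (G i) (p, s p)| <= e * `|k|.
  by move=> kd; apply: Hd'; rewrite /= sub0r normrN.
have h1 : \forall h \near (0 : P), implicit_at (h + p) z0 r by exact: (near_addr near_p).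
have d20 : 0 < d / 2 by rewrite divr_gt0.
have h2 : \forall h \near (0 : P), `|s (h + p) - s p| < d / 2.
  have /cvgrPdist_lt/(_ _ d20) := solution_continuous => /near_addr; apply: filterS => h.
  by rewrite /= distrC.
have h3 : \forall h \near (0 : P), `|h| < d / 2.
  by apply/nbhs_normP; exists (d / 2) => // h; rewrite /= sub0r normrN.
apply: filterS3 h1 h2 h3 => h imp' kd hd.
pose k : 'cV[R]_N := s (h + p) - s p.
have E0 : Dg (p, s p) (0, k - ds h) = Dg (p, s p) (h, k).
  rewrite (_ : (0, k - ds h) = (h, k) - (h, ds h)); last first.
    by rewrite -[RHS]/(h - h, k - ds h) subrr.
  by rewrite DgB ds_eq subr0.
have := expansive_lin imp.1 (k - ds h) (s_in imp); rewrite E0 -/k => H.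
apply: le_trans H _; rewrite -[leRHS]mulrA; apply: ler_wpM2l; first exact: ler0n.
apply: cV_norm_le => [|i]; first by apply: mulr_ge0; [exact: ltW|apply: addr_ge0].
rewrite mxE.
have := Hd (h, k) => /(_ _ i).
rewrite -[(h, k) + (p, s p)]/(h + p, k + s p) subrK.
have -> : G i (h + p, s (h + p)) = 0 by have /colP/(_ i) := s_zero imp'; rewrite !mxE.
have -> : G i (p, s p) = 0 by have /colP/(_ i) := s_zero imp; rewrite !mxE.
rewrite subrr sub0r normrN => H; apply: le_trans (H _) _.
  by apply: le_lt_trans (pair_norm_le _ _) _; rewrite [ltRHS]splitr ltrD.
by apply: ler_wpM2l; [exact: ltW|exact: pair_norm_le].
Qed.

Lemma solution_differentiable : differentiable s p /\ forall v, 'D_v s p = ds v.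
Proof.
apply: differentiable_of_eps; [exact: ds_linear|exact: ds_continuous|move=> e e0].
have [C C0 HC] : exists2 C : R, 0 < C & forall h, `|ds h| <= C * `|h|.
  pose f : {linear P -> 'cV[R]_N} := HB.pack ds (GRing.isLinear.Build _ _ _ _ ds ds_linear).
  exact: (@linear_lipschitz _ _ _ f ds_continuous).
have D0 : 0 < 2 * (2 * C + 2) by rewrite mulr_gt0// addr_gt0// mulr_gt0.
(* The bound 1/4 lets [|k|] be absorbed on the left, giving [|k| <= (2 * C + 1) * |h|]; the other
   bound then brings the error below [e * |h|]. *)
pose t := Num.min 4^-1 (e / (2 * (2 * C + 2))).
have t0 : 0 < t by rewrite lt_min invr_gt0 divr_gt0// ltr0n.
have t4 : t <= 4^-1 by rewrite ge_min lexx.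
have te : t * (2 * (2 * C + 2)) <= e by rewrite -ler_pdivlMr// ge_min lexx orbT.
have := solution_expansion t0; apply: filterS => h; set k := s (h + p) - s p => H.
have k1 : `|k| <= `|k - ds h| + `|ds h| by rewrite -{1}(subrK (ds h) k) ler_normD.
have Ch := HC h.
have n1 := normr_ge0 h; have n2 := normr_ge0 k.
have k2 : `|k| <= (2 * C + 1) * `|h|.
  have : t * (`|h| + `|k|) <= 4^-1 * (`|h| + `|k|) by rewrite ler_wpM2r// addr_ge0.
  by move: H k1 Ch; set A := `|k - _|; lra.
apply: le_trans H _; apply: (@le_trans _ _ (t * (2 * (2 * C + 2)) * `|h|)).
  rewrite [leRHS](_ : _ = 2 * t * (`|h| + (2 * C + 1) * `|h|)); last by ring.
  by rewrite ler_pM2l ?mulr_gt0// lerD2l.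
by rewrite ler_wpM2r.
Qed.

(** No continuity of the matrix inverse is invoked: inserting the old derivative [d0] into the
    differentiated equation at [p'] leaves a residual tending to 0, and [expansive_lin] converts it
    into a bound on [d0 - d1]. *)
Lemma solution_C1 : (\forall p' \near p, forall v, Dg (p', s p') (v, 'D_v s p') = 0) ->
  forall v, {for p, continuous ('D_v s)}.
Proof.
move=> Ds v; apply/cvgrPdist_le => e e0; have e20 : 0 < e / 2 by rewrite divr_gt0.
pose d0 := 'D_v s p.
have c : {for p, continuous (fun p' => Dg (p', s p') (v, d0))}.
  apply: continuous_cV => i.
  rewrite (_ : (fun _ => _) = (fun y => 'D_(v, d0) (G i) (y, s y))); last first.
    by apply: funext => y; rewrite mxE.
  apply: (@continuous_comp _ _ _ (fun y : P => (y, s y)) ('D_(v, d0) (G i))).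
    by apply: continuous_pair; [move=> ?; exact|exact: solution_continuous].
  exact: (C1_continuousD (G1 i)).
have /cvgrPdist_lt/(_ _ e20) := c.
rewrite (nbhs_singleton Ds v).
apply: filterS3 near_p Ds => p' imp' /(_ v); move: ('D_v s p') => d1 Dd1.
rewrite sub0r normrN => h.
have := expansive_lin imp'.1 (d0 - d1) (s_in imp').
rewrite (_ : (0, d0 - d1) = (v, d0) - (v, d1)); last first.
  by rewrite -[RHS]/(v - v, d0 - d1) subrr.
rewrite DgB Dd1 subr0; set A := `|d0 - _|; move: h; lra.
Qed.

End Solution.

Lemma implicit_normalized (p0 : P) (z0 : 'cV[R]_N) (Phi : P -> set 'cV[R]_N) :
  (forall i, G i (p0, z0) = 0) ->
  (forall i j, 'D_(0, delta_mx j 0) (G i) (p0, z0) = (i == j)%:R) ->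
  (\forall q \near (p0, z0), Phi q.1 q.2 <-> forall i, G i q = 0) ->
  C1_localization Phi p0 z0.
Proof.
move=> G0 D0 PhiG.
have [r r0 Hr] : exists2 r : R, 0 < r & forall p z, `|p0 - p| < r -> `|z0 - z| < r ->
    close_to_id p z /\ (Phi p z <-> g p z = 0).
  have [[A B] /= [nA nB] AB] := filterI (near_close_to_id D0) PhiG.
  move: nA nB => /nbhs_normP[a /= a0 Ha] /nbhs_normP[b /= b0 Hb].
  exists (Num.min a b); first by rewrite lt_min a0.
  move=> p z; rewrite !lt_min => /andP[pa _] /andP[_ zb].
  have [c1 c2] := AB (p, z) (conj (Ha p pa) (Hb z zb)); split => //.
  apply: (iff_trans c2); split=> [G0'|/colP g0 i]; last by have := g0 i; rewrite !mxE.
  by apply/colP => i; rewrite !mxE.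
pose A := [set p | `|p0 - p| < r /\ `|g p z0| < r / 4].
have impA p : A p -> implicit_at p z0 r.
  by move=> [pr gr]; split=> // z zr; have [] := Hr p z pr zr.
have /choice[s Hs] : forall p, exists z : 'cV[R]_N, implicit_at p z0 r ->
    `|z0 - z| < r /\ g p z = 0.
  move=> p; have [[cl gr]|nA] := pselect (implicit_at p z0 r); last by exists 0.
  have [z zr gz] := newton_zero cl r0 gr.
  by exists z => _; split => //; rewrite distrC (le_lt_trans zr)//; lra.
have nA : nbhs p0 A.
  apply: filterI; first exact: nbhs_norm_lt.
  have gc : {for p0, continuous (fun p' => g p' z0)}.
    apply: continuous_cV => i.
    rewrite (_ : (fun _ => _) = (fun y => G i (y, z0))); last first.
      by apply: funext => y; rewrite mxE.
    apply: (@continuous_comp _ _ _ (fun y : P => (y, z0)) (G i)).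
      by apply: continuous_pair; [move=> ?; exact|exact: cst_continuous].
    exact: (C1_continuous (G1 i)).
  have r40 : 0 < r / 4 by rewrite divr_gt0.
  have /cvgrPdist_lt/(_ _ r40) := gc; apply: filterS => p /=.
  suff -> : g p0 z0 = 0 by rewrite sub0r normrN.
  by apply/colP => i; rewrite !mxE.
(* Passing to the interior of [A] makes the domain open, so the solution lemmas, which need
   [implicit_at] in a neighbourhood, apply at each of its points. *)
have U_near p : A° p -> \forall p' \near p, A° p'.
  by move=> Ap; apply: open_nbhs_nbhs; split => //; exact: open_interior.
have U_near' p : A° p -> \forall p' \near p, implicit_at p' z0 r.
  by move=> /U_near; apply: filterS => p' /interior_subset /impA.
have s_in p : implicit_at p z0 r -> `|z0 - s p| < r by move=> /Hs[].
have s_zero p : implicit_at p z0 r -> g p (s p) = 0 by move=> /Hs[].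
have diff p : A° p -> differentiable s p /\ forall v, Dg (p, s p) (v, 'D_v s p) = 0.
  move=> /U_near' np; have [ds Ds] := solution_differentiable np s_in s_zero.
  by split=> // v; rewrite Ds (ds_eq np s_in).
split.
  have /nbhs_singleton/= := PhiG.
  by case=> _; apply.
exists A°, [set z | `|z0 - z| < r], s; split.
- by split; [exact: open_interior|exact: nA].
- exact: nbhs_norm_lt.
- by move=> p /interior_subset /impA /s_in.
- move=> p z /interior_subset Ap /= zr; have [pr _] := Ap.
  have imp := impA _ Ap.
  apply: (iff_trans (Hr p z pr zr).2); split=> [gz|->]; last exact: s_zero.
  have := expansive_map imp.1 (s_in _ imp) zr; rewrite gz s_zero// subrr normr0 mulr0.
  by rewrite normr_le0 subr_eq0 => /eqP.
- move=> p Up; split; first by have [] := diff p Up.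
  apply: (solution_C1 (U_near' _ Up) s_in s_zero).
  by have := U_near _ Up; apply: filterS => p' /diff[].
Qed.

End NormalizedImplicit.

(** Left multiplication by the inverse of the partial Jacobian preserves zeros and smoothness, and
    makes the Jacobian at the base point the identity. *)
Lemma implicit_function (P : normedModType R) N (F : 'I_N -> P * 'cV[R]_N -> R)
    (p0 : P) (z0 : 'cV[R]_N) (Phi : P -> set 'cV[R]_N) :
  (forall i, C1_on setT (F i)) ->
  (forall i, F i (p0, z0) = 0) ->
  (forall y, (forall i, 'D_(0, y) (F i) (p0, z0) = 0) -> y = 0) ->
  (\forall q \near (p0, z0), Phi q.1 q.2 <-> forall i, F i q = 0) ->
  C1_localization Phi p0 z0.
Proof.
move=> F1 F0 Finj PhiF.
pose A : 'M[R]_N := \matrix_(i, j) 'D_(0, delta_mx j 0) (F i) (p0, z0).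
have Au : A \in unitmx.
  apply: unitmx_of_injective => y /colP Ay; apply: Finj => i.
  rewrite (derive_dir_delta y (C1_differentiable _ (F1 i)) (@linear_inr P N)).
  transitivity ((A *m y) i 0); last by rewrite Ay mxE.
  by rewrite mxE; apply: eq_bigr => j _; rewrite mxE mulrC.
pose G i q := \sum_j invmx A i j * F j q.
have FG q : (forall i, G i q = 0) <-> (forall i, F i q = 0).
  split=> [H i|H i]; last by apply: big1 => j _; rewrite H mulr0.
  suff : A *m (invmx A *m \col_j F j q) = 0.
    by rewrite mulKVmx// => /colP/(_ i); rewrite !mxE.
  rewrite [X in A *m X](_ : _ = 0) ?mulmx0//; apply/colP => j; rewrite !mxE -[RHS](H j).
  by apply: eq_bigr => k _; rewrite mxE.
apply: (@implicit_normalized _ _ G).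
- by move=> i; apply: C1_sum => j _; apply: (C1M (C1_cst _) (F1 j)).
- by move=> i; apply FG.
- move=> i j; have -> : (i == j)%:R = (invmx A *m A) i j by rewrite mulVmx// mxE.
  rewrite mxE derive_fun_sum; last first.
    by move=> k _; apply: (C1M (C1_cst _) (F1 k)).
  by apply: eq_bigr => k _; rewrite derive_scale// mxE.
- by apply: filterS PhiF => q ->; apply: iff_sym.
Qed.

(** Transports the result from a single column of unknowns to the pair [(x, lambda)]. *)
Lemma C1_localization_iso (P : normedModType R) (X Y : normedModType R) (Phi : P -> set Y)
    (L : X -> Y) (L' : Y -> X) p y :
  contlin L -> contlin L' -> cancel L L' -> cancel L' L ->
  C1_localization (fun p x => Phi p (L x)) p (L' y) -> C1_localization Phi p y.
Proof.
move=> cL cL' LK LK' [Py [U [V [s [nU nV sV graph s1]]]]].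
split; first by rewrite -[y]LK'.
have U_open q : U q -> \forall q' \near q, U q'.
  by move=> Uq; apply: open_nbhs_nbhs; split => //; case: nU.
have DL q v : U q -> 'D_v (L \o s) q = L ('D_v s q).
  move=> Uq; have ds := (s1 q Uq).1.
  have dL := differentiable_linear (s q) cL.1 cL.2.
  rewrite (deriveE _ (differentiable_comp ds dL)) (diff_comp ds dL) /=.
  by rewrite -(deriveE _ ds) -(deriveE _ dL) (derive_linear _ _ cL.1).
exists U, (L' @^-1` V), (L \o s); split => //.
- exact: cL'.2.
- by move=> q Uq; rewrite /= LK; exact: sV.
- move=> q z Uq Vz; rewrite -{1}[z]LK'.
  apply: (iff_trans (graph q (L' z) Uq Vz)); split=> [e|->]; first by rewrite /= -e LK'.
  by rewrite /= LK.
- move=> q Uq; have [ds cs] := s1 q Uq; split.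
    exact: differentiable_comp ds (differentiable_linear (s q) cL.1 cL.2).
  move=> v.
  have cc : {for q, continuous (fun q => L ('D_v s q))}.
    by apply: continuous_comp; [exact: cs|exact: cL.2].
  apply/cvgrPdist_lt => e e0; have /cvgrPdist_lt/(_ e e0) := cc.
  by apply: filterS2 (U_open q Uq) => q' Uq'; rewrite !DL.
Qed.

(** * Quadratic forms *)

Lemma dotE n (x y : 'cV[R]_n) : dot x y = \sum_i x i 0 * y i 0.
Proof. by rewrite /dot mxE; apply: eq_bigr => i _; rewrite mxE. Qed.

Lemma dotC n (x y : 'cV[R]_n) : dot x y = dot y x.
Proof. by rewrite !dotE; apply: eq_bigr => i _; rewrite mulrC. Qed.

Lemma dotDr n (x y z : 'cV[R]_n) : dot x (y + z) = dot x y + dot x z.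
Proof. by rewrite /dot mulmxDr mxE. Qed.

Lemma dotZr n (x y : 'cV[R]_n) a : dot x (a *: y) = a * dot x y.
Proof. by rewrite /dot -scalemxAr mxE. Qed.

Lemma dot0r n (x : 'cV[R]_n) : dot x 0 = 0.
Proof. by rewrite /dot mulmx0 mxE. Qed.

Lemma dotBr n (x y z : 'cV[R]_n) : dot x (y - z) = dot x y - dot x z.
Proof. by rewrite -scaleN1r dotDr dotZr mulN1r. Qed.

Lemma dotDl n (x y z : 'cV[R]_n) : dot (x + y) z = dot x z + dot y z.
Proof. by rewrite dotC dotDr !(dotC z). Qed.

Lemma dotZl n (x y : 'cV[R]_n) a : dot (a *: x) y = a * dot x y.
Proof. by rewrite dotC dotZr dotC. Qed.

Lemma dot0l n (x : 'cV[R]_n) : dot 0 x = 0.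
Proof. by rewrite dotC dot0r. Qed.

Lemma dot_mulmx m n (A : 'M[R]_(m, n)) x y : dot x (A *m y) = dot (A^T *m x) y.
Proof. by rewrite /dot trmx_mul trmxK mulmxA. Qed.

Lemma posdef_unit n (C : 'M[R]_n) :
  (forall z, z != 0 -> 0 < dot z (C *m z)) -> C \in unitmx.
Proof.
move=> pos; apply: unitmx_of_injective => z Cz; apply/eqP; apply: contraT => z0.
by have := pos z z0; rewrite Cz dot0r ltxx.
Qed.

(* The value [- (4 a)^-1 <b, C^-1 b>] is the minimum over [z] of [a <z, C z> + <z, b>]. *)
Lemma quadratic_min n (C : 'M[R]_n) (a : R) (b z : 'cV[R]_n) :
  C^T = C -> (forall z, z != 0 -> 0 < dot z (C *m z)) -> 0 < a ->
  0 <= a * dot z (C *m z) + dot z b + (4 * a)^-1 * dot b (invmx C *m b).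
Proof.
move=> symC pos a0; pose u := invmx C *m b.
have Cu : C *m u = b by rewrite mulKVmx// posdef_unit.
have : 0 <= a * dot (z + (2 * a)^-1 *: u) (C *m (z + (2 * a)^-1 *: u)).
  apply: mulr_ge0; first exact: ltW.
  have [->|w0] := eqVneq (z + (2 * a)^-1 *: u) 0.
    by rewrite dot0l.
  exact/ltW/pos.
rewrite mulmxDr -scalemxAr Cu !dotDr !dotDl !dotZr !dotZl.
rewrite [dot u (C *m z)]dot_mulmx symC Cu (dotC b z) -/u (dotC b u) => h.
apply: le_trans h _; rewrite le_eqVlt; apply/orP; left; apply/eqP.
by field; rewrite gt_eqF.
Qed.

Lemma pairwise_posdef (I : finType) (d q : I -> nat)
    (H : forall i k, 'M[R]_(d i, d k)) (B : forall i, 'M[R]_(d i, q i))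
    (M : forall i, set 'cV[R]_(d i)) (alpha : I -> I -> R) :
  (forall i, (H i i)^T = H i i) ->
  (forall i y, M i y -> exists z, y = B i *m z) ->
  (forall i z, z != 0 -> 0 < dot z (((B i)^T *m H i i *m B i) *m z)) ->
  (forall i j, j != i -> 0 < alpha i j) ->
  (forall i, \sum_(j | j != i) alpha i j = 1) ->
  (forall i k, i != k -> forall y, y != 0 -> M k y ->
    0 < dot y ((H k k - (4 * alpha i k * alpha k i)^-1 *:
      ((H i k + (H k i)^T)^T *m B i *m invmx ((B i)^T *m H i i *m B i)
        *m (B i)^T *m (H i k + (H k i)^T))) *m y)) ->
  forall y : forall i, 'cV[R]_(d i), (forall i, M i (y i)) -> (exists k, y k != 0) ->
    0 < \sum_i \sum_k dot (y i) (H i k *m y k).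
Proof.
move=> symH BM Bpos alpha0 alpha1 iv y My [k0 yk0].
pose T i k := alpha i k * dot (y i) (H i i *m y i) + alpha k i * dot (y k) (H k k *m y k)
  + dot (y i) ((H i k + (H k i)^T) *m y k).
have T_ge i k : i != k -> 0 <= T i k /\ (y k != 0 -> 0 < T i k).
  (* Coordinates [z] in the basis [B i] turn minimization over the subspace into unconstrained
     minimization. *)
  move=> ik; have [z yi] := BM i (y i) (My i).
  set A := H i k + (H k i)^T; set C := (B i)^T *m H i i *m B i.
  have symC : C^T = C by rewrite /C !trmx_mul trmxK symH mulmxA.
  have aik : 0 < alpha i k by apply: alpha0; rewrite eq_sym.
  have aki : 0 < alpha k i by exact: alpha0.
  set b := (B i)^T *m (A *m y k).
  have := quadratic_min b z symC (Bpos i) aik.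
  have -> : dot z (C *m z) = dot (y i) (H i i *m y i).
    by rewrite yi /C -!mulmxA dot_mulmx trmxK.
  have -> : dot z b = dot (y i) (A *m y k) by rewrite yi /b dot_mulmx trmxK.
  have -> : dot b (invmx C *m b) =
      dot (y k) ((A^T *m B i *m invmx C *m (B i)^T *m A) *m y k).
    by rewrite -!mulmxA [RHS]dot_mulmx trmxK [RHS]dot_mulmx.
  have := iv i k ik (y k); rewrite -/A -/C; set K := _ *m A.
  rewrite mulmxBl dotBr -scalemxAl dotZr /T -/A => ivk quad.
  (* Multiplying (iv) by [alpha k i] leaves exactly the coefficient [(4 * alpha i k)^-1] of
     [quadratic_min]. *)
  have e : alpha k i * ((4 * alpha i k * alpha k i)^-1 * dot (y k) (K *m y k)) =
      (4 * alpha i k)^-1 * dot (y k) (K *m y k).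
    by field; rewrite !gt_eqF.
  have [y0|y0] := eqVneq (y k) 0.
    split => //; move: quad; rewrite y0 !mulmx0 !dot0l !dot0r !mulr0 !addr0.
    by [].
  have := ivk y0 (My k); rewrite -(pmulr_rgt0 _ aki) mulrBr e => pos.
  by split=> [|_]; move: pos quad; lra.
(* Summation over ordered pairs counts each pair twice, hence the factor 2; the diagonal terms
   reassemble because the weights of each [i] sum to 1. *)
have sumT : \sum_i \sum_(k | k != i) T i k = 2 * \sum_i \sum_k dot (y i) (H i k *m y k).
  pose S1 := \sum_i dot (y i) (H i i *m y i).
  pose S2 := \sum_i \sum_(k | k != i) dot (y i) (H i k *m y k).
  have swap (f : I -> I -> R) :
      \sum_i \sum_(k | k != i) f k i = \sum_i \sum_(k | k != i) f i k.
    rewrite (exchange_big_dep xpredT)//=; apply: eq_bigr => i _.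
    by apply: eq_bigl => j; rewrite eq_sym.
  have e1 : \sum_i \sum_(k | k != i) alpha i k * dot (y i) (H i i *m y i) = S1.
    by apply: eq_bigr => i _; rewrite -big_distrl/= alpha1 mul1r.
  have -> : \sum_i \sum_k dot (y i) (H i k *m y k) = S1 + S2.
    by rewrite -big_split; apply: eq_bigr => i _; rewrite (bigD1 i).
  have -> : \sum_i \sum_(k | k != i) T i k = S1 + S1 + (S2 + S2).
    have e2 : \sum_i \sum_(k | k != i) alpha k i * dot (y k) (H k k *m y k) = S1.
      by rewrite -e1 -(swap (fun i k => alpha i k * dot (y i) (H i i *m y i))).
    have e3 : \sum_i \sum_(k | k != i) dot (y k) (H k i *m y i) = S2.
      exact: (swap (fun i k => dot (y i) (H i k *m y k))).
    rewrite -{1}e1 -e2 -{2}e3 /S2 -!big_split.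
    apply: eq_bigr => i _; rewrite -!big_split; apply: eq_bigr => k _ /=.
    rewrite /T mulmxDl dotDr -!addrA; congr (_ + (_ + (_ + _))).
    by rewrite dot_mulmx trmxK dotC.
  by ring.
rewrite -(pmulr_rgt0 _ (ltr0Sn R 1)) -sumT.
(* A second index exists since an empty sum of weights would be 0, not 1. The pair [(i, k0)] then
   supplies the strict inequality. *)
have [i ik] : exists i, i != k0.
  apply: contrapT => /forallNP no.
  have := alpha1 k0; rewrite big_pred0; last by move=> j; apply/negbTE/negP; exact: no.
  by move=> /eqP; rewrite eq_sym oner_eq0.
have k0i : k0 != i by rewrite eq_sym.
rewrite (bigD1 i)//= (bigD1 k0)//= -addrA; apply: ltr_pwDl; first by have [_] := T_ge i k0 ik; apply.
apply: addr_ge0; first by apply: sumr_ge0 => k /andP[ki _]; have [] := T_ge i k; rewrite // eq_sym.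
apply: sumr_ge0 => j _; apply: sumr_ge0 => k kj.
by have [] := T_ge j k; rewrite // eq_sym.
Qed.

Lemma continuous_dot_mulmx m (M : 'M[R]_m) : continuous (fun d : 'cV[R]_m => dot d (M *m d)).
Proof.
move=> d; rewrite (_ : (fun _ => _) = fun d : 'cV[R]_m => \sum_i d i 0 * (M *m d) i 0); last first.
  by apply: funext => y; rewrite dotE.
apply: (@cvg_sum _ _ (nbhs d)) => i _; apply: cvgM; first exact: coord_continuous.
by apply: linear_continuous_mx => a x y; rewrite mulmxDr -scalemxAr !mxE.
Qed.

Lemma continuous_sum_sqr_dot m (I : finType) (S : pred I) (g : I -> 'cV[R]_m) :
  continuous (fun d : 'cV[R]_m => \sum_(i | S i) dot (g i) d ^+ 2).
Proof.
move=> d; apply: (@cvg_sum _ _ (nbhs d)) => i _.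
have cg : {for d, continuous (fun d : 'cV[R]_m => dot (g i) d)}.
  by apply: linear_continuous_mx => a x y; rewrite dotDr dotZr.
exact: (cvgM cg cg).
Qed.

(** * Derivatives of the Lagrangians *)

Section Blocks.
Variables (n : nat) (p_ : 'I_n -> nat).

(** Extension of one block by zero, written in the basis vectors that define [partial]. *)
Definition emb k (d : 'cV[R]_(p_ k)) : 'cV[R]_(\sum_(j < n) p_ j)%N :=
  \sum_a d a 0 *: delta_mx (tagnat.Rank k a) 0.

Lemma emb_linear k : linear (@emb k).
Proof.
move=> a x y; rewrite /emb scaler_sumr -big_split; apply: eq_bigr => i _ /=.
by rewrite !mxE scalerDl scalerA.
Qed.

Lemma emb0 k : @emb k 0 = 0.
Proof. by rewrite /emb [LHS]big1 // => i _; rewrite mxE scale0r. Qed.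

Lemma emb_delta k a : @emb k (delta_mx a 0) = delta_mx (tagnat.Rank k a) 0.
Proof.
rewrite /emb (bigD1 a)//= [X in _ + X]big1 ?addr0 => [|i ia]; first by rewrite mxE !eqxx scale1r.
by rewrite mxE (negPf ia) scale0r.
Qed.

Lemma submxcol_emb k (d : 'cV[R]_(p_ k)) : submxcol (emb d) k = d.
Proof.
apply/colP => a; rewrite mxE /emb summxE (bigD1 a)//= [X in _ + X]big1 ?addr0 => [|i ia].
  by rewrite !mxE !eqxx mulr1.
rewrite !mxE -val_eqE /= tagnat.eq_Rank eqxx/= val_eqE eq_sym (negPf ia).
by rewrite mulr0.
Qed.

Lemma submxcol_emb_neq j k (d : 'cV[R]_(p_ k)) : j != k -> submxcol (emb d) j = 0.
Proof.
move=> jk; apply/colP => a; rewrite !mxE /emb summxE big1 // => i _.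
by rewrite !mxE -val_eqE /= tagnat.eq_Rank (negPf jk) mulr0.
Qed.

Lemma sum_emb (x : 'cV[R]_(\sum_(j < n) p_ j)%N) : x = \sum_k emb (submxcol x k).
Proof.
apply/mxcolP => j; rewrite submxcol_sum (bigD1 j)//= submxcol_emb [X in _ + X]big1 ?addr0// => i ij.
by rewrite submxcol_emb_neq// eq_sym.
Qed.

Lemma submxcol_linear k :
  linear (fun x : 'cV[R]_(\sum_(j < n) p_ j)%N => submxcol x k).
Proof. by move=> a x y; apply/colP => i; rewrite !mxE. Qed.

End Blocks.

Section Game.
Variable G : nep R.
Hypothesis obj_C2 : forall k : 'I_(nplayers G), C2 (obj (n:=G) (k:=k)).
Hypothesis con_C2 : forall (k : 'I_(nplayers G)) (i : 'I_(dimg k)), C2 (con i).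
Local Notation pt := (param G * (strategy G * multiplier G))%type.
Local Notation player := 'I_(nplayers G).

Lemma contlin_xk (k : player) : contlin (fun q : pt => xk q.2.1 k).
Proof.
apply: contlin_comp; last by apply: contlin_mx; exact: submxcol_linear.
by apply: contlin_comp; [exact: contlin_snd|exact: contlin_fst].
Qed.

Lemma contlin_lamk (k : player) : contlin (fun q : pt => lamk q.2.2 k).
Proof.
apply: contlin_comp; last by apply: contlin_mx; exact: submxcol_linear.
by apply: contlin_comp; [exact: contlin_snd|exact: contlin_snd].
Qed.

Lemma contlin_uk (k : player) : contlin (fun q : pt => uk q.1 k).
Proof.
apply: contlin_comp; last by apply: contlin_mx; exact: submxcol_linear.
apply: contlin_comp; last exact: contlin_fst.
by apply: contlin_comp; [exact: contlin_fst|exact: contlin_fst].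
Qed.

Lemma contlin_vk (k : player) : contlin (fun q : pt => vk q.1 k).
Proof.
apply: contlin_comp; last by apply: contlin_mx; exact: submxcol_linear.
apply: contlin_comp; last exact: contlin_snd.
by apply: contlin_comp; [exact: contlin_fst|exact: contlin_fst].
Qed.

Lemma contlin_wk (k : player) : contlin (fun q : pt => wk q.1 k).
Proof.
apply: contlin_comp; last by apply: contlin_mx; exact: submxcol_linear.
by apply: contlin_comp; [exact: contlin_fst|exact: contlin_snd].
Qed.

Definition slack (k : player) (i : 'I_(dimg k)) (q : pt) : R :=
  con i (xk q.2.1 k, wk q.1 k) - uk q.1 k i 0.

(** The terms in [v] and [u] make the KKT system homogeneous: stationarity says that the derivatives
    in [x^k] vanish, and derivatives in [lambda] are slacks. Second derivatives in [x] are those of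
    the Lagrangian. *)
Definition lag (k : player) (q : pt) : R :=
  obj (q.2.1, wk q.1 k) - dot (vk q.1 k) (xk q.2.1 k)
  + \sum_(i < dimg k) lamk q.2.2 k i 0 * slack i q.

Lemma C2_slack k i : C2 (@slack k i).
Proof.
apply: (C2D (f := fun q : pt => con i (xk q.2.1 k, wk q.1 k)) (g := fun q : pt => - uk q.1 k i 0)).
  apply: (C2_comp (f := con i) (L := fun q : pt => (xk q.2.1 k, wk q.1 k))) => //.
  exact: contlin_pair (contlin_xk k) (contlin_wk k).
exact: C2N (C2_contlin (contlin_coord i (contlin_uk k))).
Qed.

Lemma C2_lag k : C2 (lag k).
Proof.
apply: (C2D (f := fun q : pt => obj (q.2.1, wk q.1 k) - dot (vk q.1 k) (xk q.2.1 k))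
  (g := fun q : pt => \sum_(i < dimg k) lamk q.2.2 k i 0 * slack i q)).
  apply: (C2D (f := fun q : pt => obj (q.2.1, wk q.1 k))
    (g := fun q : pt => - dot (vk q.1 k) (xk q.2.1 k))).
    apply: (C2_comp (f := obj (n:=G) (k:=k)) (L := fun q : pt => (q.2.1, wk q.1 k))) => //.
    apply: contlin_pair (contlin_wk k).
    by apply: contlin_comp; [exact: contlin_snd|exact: contlin_fst].
  apply: C2N; under eq_fun do rewrite dotE.
  apply: C2_sum => i _.
  exact: C2M (C2_contlin (contlin_coord i (contlin_vk k)))
    (C2_contlin (contlin_coord i (contlin_xk k))).
apply: C2_sum => i _.
exact: C2M (C2_contlin (contlin_coord i (contlin_lamk k))) (C2_slack i).
Qed.

Definition dirx (k : player) (d : 'cV[R]_(dimx k)) : pt := (0, (emb d, 0)).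

Lemma dirx_linear k : linear (@dirx k).
Proof.
move=> a x y; rewrite /dirx emb_linear.
by rewrite -[RHS]/(a *: 0 + 0, (a *: emb x + emb y, a *: 0 + 0)) !scaler0 !addr0.
Qed.

Lemma deviate_emb (x : strategy G) k (d : 'cV[R]_(dimx k)) :
  deviate x (xk x k + d) = x + emb d.
Proof.
apply/mxcolP => j; rewrite /deviate mxcolK submxcolD.
have [->|jk] := eqVneq j k; first by rewrite dfwith_in submxcol_emb.
by rewrite dfwith_out 1?eq_sym// submxcol_emb_neq// addr0.
Qed.

(** Lets gradients and Hessians, defined by varying the strategy alone, be read on the product
    space. *)
Lemma derive_slice (f : pt -> R) p (x e : strategy G) (l : multiplier G) :
  'D_e (fun x' : strategy G => f (p, (x', l))) x = 'D_((0, (e, 0)) : pt) f (p, (x, l)).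
Proof.
apply: (@derive_comp_affine _ _ _ f (fun x' : strategy G => (p, (x', l)) : pt)) => h.
by rewrite -[RHS]/(h *: 0 + p, (h *: e + x, h *: 0 + l)) !scaler0 !add0r.
Qed.

Lemma differentiable_slice (f : pt -> R) p (x : strategy G) (l : multiplier G) :
  C1_on setT f -> differentiable (fun x' : strategy G => f (p, (x', l))) x.
Proof.
move=> f1; have cL : contlin (fun y : strategy G => (0, (y, 0)) : pt).
  apply: contlin_pair (contlin0 _ _) _.
  exact: contlin_pair (contlin_id _) (contlin0 _ _).
have := C1_comp_linear cL.1 cL.2 (C1_shift (p, (0, l)) f1).
rewrite (_ : _ \o _ = fun x' => f (p, (x', l))); first exact: C1_differentiable.
apply: funext => y /=; congr f.
by rewrite -[LHS]/(0 + p, (y + 0, 0 + l)) !add0r addr0.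
Qed.

Lemma derive_lagrangian k (q : pt) (e : strategy G) :
  'D_e (lagrangian (lamk q.2.2 k) (wk q.1 k)) q.2.1 =
  'D_((0, (e, 0)) : pt) (lag k) q + dot (vk q.1 k) (xk e k).
Proof.
case: q => p [x l] /=.
pose c := \sum_i lamk l k i 0 * uk p k i 0.
rewrite (_ : lagrangian _ _ =
    fun x' => lag k (p, (x', l)) + dot (vk p k) (xk x' k) + c); last first.
  apply: funext => y; rewrite /lagrangian /lag /slack /c /=.
  set A := obj _; set D := dot _ _.
  have -> : \sum_(i < dimg k) lamk l k i 0 * (con i (xk y k, wk p k) - uk p k i 0) =
      \sum_(i < dimg k) lamk l k i 0 * con i (xk y k, wk p k)
      - \sum_(i < dimg k) lamk l k i 0 * uk p k i 0.
    by rewrite -sumrB; apply: eq_bigr => i _; rewrite mulrBr.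
  by ring.
have cd : contlin (fun x' : strategy G => dot (vk p k) (xk x' k)).
  apply: contlin_mx => a y z.
  by rewrite /xk submxcol_linear dotDr dotZr.
rewrite derive_add_affine; [|exact: differentiable_slice (C2_C1 (C2_lag k))|exact: cd.1|exact: cd.2].
by rewrite derive_slice.
Qed.

Lemma grad_lagrangianE k (a : 'I_(dimx k)) (q : pt) :
  grad_lagrangian q.1 q.2.1 q.2.2 k a 0 =
  'D_(dirx (delta_mx a 0)) (lag k) q + vk q.1 k a 0.
Proof.
rewrite mxE /partial derive_lagrangian /dirx -emb_delta; congr (_ + _).
rewrite /xk submxcol_emb dotE (bigD1 a)//= [X in _ + X]big1 ?addr0.
  by rewrite delta_cVE eqxx mulr1.
by move=> i ia; rewrite delta_cVE (negPf ia) mulr0.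
Qed.

Lemma hess_lagrangianE k i (a : 'I_(dimx k)) (b : 'I_(dimx i)) (q : pt) :
  hess_lagrangian q.1 q.2.1 q.2.2 k i a b =
  'D_(dirx (delta_mx a 0)) ('D_(dirx (delta_mx b 0)) (lag k)) q.
Proof.
rewrite mxE /partial.
(* The summand [0] is the zero linear map, which gives the function the shape required by
   [derive_add_affine]. *)
rewrite (_ : (fun x => derive _ x (delta_mx (tagnat.Rank i b) 0)) =
   fun x => 'D_(dirx (delta_mx b 0)) (lag k) (q.1, (x, q.2.2)) + 0 +
   dot (vk q.1 k) (xk (emb (delta_mx b 0)) k)); last first.
  apply: funext => x.
  rewrite (derive_lagrangian k (q.1, (x, q.2.2))) /dirx emb_delta /= addr0.
  by [].
have f1 := (C2_lag k).2 (dirx (delta_mx b 0)).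
have := contlin0 (strategy G) R => -[l0 c0].
have := derive_add_affine (dot (vk q.1 k) (xk (emb (delta_mx b 0)) k))
  (delta_mx (tagnat.Rank k a) 0 : strategy G) (differentiable_slice q.1 q.2.1 q.2.2 f1) l0 c0.
move=> ->; rewrite addr0.
rewrite (derive_slice ('D_(dirx (delta_mx b 0)) (lag k))) /dirx !emb_delta.
by case: q {f1} => p [x l].
Qed.

Lemma derive_slack k (i : 'I_(dimg k)) (q : pt) (y : strategy G) (m : multiplier G) :
  'D_((0, (y, m)) : pt) (slack i) q = dot (grad_con q.1 q.2.1 i) (xk y k).
Proof.
have cL := contlin_pair (contlin_xk k) (contlin_wk k).
have cu := contlin_coord i (contlin_uk k).
rewrite (_ : slack i = (con i \o (fun q : pt => (xk q.2.1 k, wk q.1 k)))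
    \+ (fun q => - uk q.1 k i 0))//.
have f2 := C2_comp cL (con_C2 i).
have u2 := C2N (C2_contlin cu).
rewrite (deriveD (diff_derivable (C1_differentiable q f2.1))
   (diff_derivable (C1_differentiable q u2.1))).
have -> : 'D_((0, (y, m)) : pt) (fun q : pt => - uk q.1 k i 0) q = 0.
  rewrite derive_linear; last by move=> a x z; rewrite cu.1 opprD scalerN.
  by rewrite /uk submxcol0 mxE oppr0.
rewrite addr0 (@derive_comp_affine _ _ _ _ _ _ _ (xk y k, 0)); last first.
  move=> h; rewrite cL.1.
  by rewrite /wk [submxcol _ _](submxcol0 _ _).
have le : linear (fun z : 'cV[R]_(dimx k) => (z, 0) : 'cV[R]_(dimx k) * 'cV[R]_(dimw k)).
  exact: (contlin_pair (contlin_id _) (contlin0 _ _)).1.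
rewrite (derive_dir_delta _ (C1_differentiable _ (C2_C1 (con_C2 i))) le) dotE.
apply: eq_bigr => a _; rewrite mxE mulrC; congr (_ * _).
rewrite [RHS]mxE -[RHS]/('D_(delta_mx a 0) (con i \o fun z => (z, wk q.1 k)) _).
apply/esym/derive_comp_affine => h.
by rewrite -[RHS]/(h *: _ + _, h *: 0 + _) scaler0 add0r.
Qed.

Lemma derive_lam k (q : pt) (m : multiplier G) :
  'D_((0, (0, m)) : pt) (lag k) q = \sum_i lamk m k i 0 * slack i q.
Proof.
case: q => p [x l].
pose c := obj (x, wk p k) - dot (vk p k) (xk x k).
pose L (l' : multiplier G) := \sum_(i < dimg k) lamk l' k i 0 * slack i (p, (x, l)).
have linL : linear L.
  move=> a y z; rewrite /L scaler_sumr -big_split; apply: eq_bigr => i _ /=.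
  by rewrite /lamk submxcol_linear !mxE mulrDl -mulrA.
transitivity ('D_m (fun l' => lag k (p, (x, l'))) l).
  apply/esym; apply: (@derive_comp_affine _ _ _ (lag k) (fun l' : multiplier G => (p, (x, l')) : pt)) => h.
  by rewrite -[RHS]/(h *: 0 + p, (h *: 0 + x, h *: m + l)) !scaler0 !add0r.
rewrite (_ : (fun _ => _) = fun l' => (fun=> 0) l' + L l' + c); last first.
  by apply: funext => l'; rewrite add0r addrC.
rewrite derive_add_affine//; first by rewrite derive_cst add0r.
exact: linear_continuous_mx.
Qed.

(** One row of the linearized stationarity equation. Exchanging the derivatives puts the Hessian in
    its defining order and, as [lag] is affine in [lambda], turns the multiplier part into
    derivatives of slacks. *)
Lemma derive_grad_lag k (a : 'I_(dimx k)) (q : pt) (y : strategy G) (m : multiplier G) :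
  'D_((0, (y, m)) : pt) ('D_(dirx (delta_mx a 0)) (lag k)) q =
  (\sum_i hess_lagrangian q.1 q.2.1 q.2.2 k i *m xk y i) a 0 +
  \sum_j lamk m k j 0 * grad_con q.1 q.2.1 j a 0.
Proof.
have f1 := (C2_lag k).2 (dirx (delta_mx a 0)).
have df := C1_differentiable q f1.
have -> : (0, (y, m)) = (0, (y, 0)) + (0, (0, m)) :> pt.
  by rewrite -[RHS]/(0 + 0, (y + 0, 0 + m)) !addr0 add0r.
rewrite derive_dirD//; congr (_ + _).
  have le : linear (fun y : strategy G => (0, (y, 0)) : pt).
    move=> c x z; rewrite -[RHS]/(c *: 0 + 0, (c *: x + z, c *: 0 + 0)).
    by rewrite !scaler0 !addr0.
  have -> : (0, (y, 0)) = \sum_i dirx (xk y i).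
    pose e : {linear strategy G -> pt} :=
      HB.pack (fun y : strategy G => (0, (y, 0)) : pt) (GRing.isLinear.Build _ _ _ _ _ le).
    by rewrite -[LHS]/(e y) {1}(sum_emb y) linear_sum.
  rewrite derive_dir_sum// summxE; apply: eq_bigr => i _.
  rewrite (derive_dir_delta _ df (@dirx_linear i)) mxE; apply: eq_bigr => b _.
  have sw := Schwarz q (dirx (delta_mx b 0)) (dirx (delta_mx a 0)) (C2_lag k).
  apply: (eq_trans (congr1 ( *:%R (xk y i b 0)) sw)).
  by rewrite -(hess_lagrangianE a b q) mulrC.
rewrite (Schwarz _ _ _ (C2_lag k)).
rewrite (_ : 'D_((0, (0, m)) : pt) (lag k) =
    fun q => \sum_i lamk m k i 0 * slack i q); last first.
  by apply: funext => q'; rewrite derive_lam.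
rewrite derive_fun_sum; last first.
  by move=> i _; exact: (C1M (C1_cst _) (C2_C1 (C2_slack i))).
apply: eq_bigr => i _.
rewrite (derive_scale (lamk m k i 0) _ q (C2_C1 (C2_slack i))) derive_slack.
rewrite /xk submxcol_emb dotE (bigD1 a)//= [X in _ + X]big1 ?addr0.
  by rewrite delta_cVE eqxx mulr1.
by move=> j ja; rewrite delta_cVE (negPf ja) mulr0.
Qed.

Lemma hess_lagrangian_sym k (q : pt) :
  (hess_lagrangian q.1 q.2.1 q.2.2 k k)^T = hess_lagrangian q.1 q.2.1 q.2.2 k k.
Proof.
apply/matrixP => a b; rewrite mxE (hess_lagrangianE b a q) (hess_lagrangianE a b q).
exact: (Schwarz _ _ _ (C2_lag k)).
Qed.

Lemma second_derivative_lag k (q : pt) (d : 'cV[R]_(dimx k)) :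
  'D_(dirx d) ('D_(dirx d) (lag k)) q =
  dot d (hess_lagrangian q.1 q.2.1 q.2.2 k k *m d).
Proof.
rewrite (second_derivative_bilinear _ _ _ (C2_lag k) (@dirx_linear k)) dotE.
apply: eq_bigr => a _; rewrite mxE big_distrr; apply: eq_bigr => b _ /=.
by rewrite hess_lagrangianE -mulrA [d b 0 * _]mulrC.
Qed.

(** * The KKT mapping near a reference point *)

Section AtPoint.
Variables (pbar : param G) (xbar : strategy G) (lbar : multiplier G).
Hypothesis KKTbar : SKKT pbar (xbar, lbar).
Hypothesis scsc : forall k, SCSC pbar xbar lbar k.
Local Notation qbar := ((pbar, (xbar, lbar)) : pt).
Local Notation I1b := (I1 pbar xbar lbar).

(* Strict complementarity freezes the active set around the reference point. *)
Definition same_active (q : pt) : Prop :=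
  forall k (i : 'I_(dimg k)),
    if i \in I1b k then (numeq k <= i)%N -> 0 < lamk q.2.2 k i 0 else slack i q < 0.

(** All the conditions are strict inequalities between continuous functions. A vanishing slack
    outside [I1] would put the index in [I2], which strict complementarity makes empty. *)
Lemma near_same_active : \forall q \near qbar, same_active q.
Proof.
apply: near_forall => k; apply: near_forall => i.
have [_ _ /(_ i) H] := KKTbar k.
have [iI|iI] := boolP (i \in I1b k).
  move: iI; rewrite inE; case: (leqP (numeq k) i) => /= [ki /andP[l0 _]|ki _]; last first.
    exact: filterE.
  have cl := (contlin_coord i (contlin_lamk k)).2 qbar.
  by apply: filterS (cvgr_gt _ cl _ l0).
have : slack i qbar < 0.
  move: iI; rewrite inE negb_or -leqNgt => /andP[ki].
  rewrite ki /= negb_and => nI.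
  have [l0 cu lcu] := H ki.
  rewrite lt_neqAle subr_le0 cu andbT; apply/negP => /eqP s0.
  move: nI; rewrite -/(slack i qbar) s0 eqxx orbF -leNgt => l0'.
  have : i \in I2 pbar xbar lbar k.
    by rewrite inE ki eq_le l0 l0' -/(slack i qbar) s0 eqxx.
  by rewrite scsc inE.
have cs := C1_continuous (C2_C1 (C2_slack i)) (x := qbar).
move=> s0; exact: (cvgr_lt _ cs _ s0).
Qed.

(** The strict inequalities decide which factor of each complementarity product vanishes, and
    conversely guarantee the sign conditions. *)
Lemma SKKT_active (q : pt) : same_active q -> SKKT q.1 q.2 <->
  forall k, [/\ forall a, 'D_(@dirx k (delta_mx a 0)) (lag k) q = 0,
    forall i, i \in I1b k -> slack i q = 0
    & forall i, i \notin I1b k -> lamk q.2.2 k i 0 = 0].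
Proof.
move=> act; split.
  case: q act => p [x l] act /= H k; have [grad eqs ineqs] := H k; split.
  - move=> a; have := grad_lagrangianE a (p, (x, l)).
    rewrite -grad /= => /eqP; rewrite -subr_eq subrr => /eqP <-.
    by [].
  - move=> i iI; have := act k i; rewrite iI => lpos.
    case: (ltnP i (numeq k)) => ik.
      by rewrite /slack /= eqs// subrr.
    have [_ _ /eqP] := ineqs i ik; rewrite mulf_eq0 gt_eqF ?lpos//= => /eqP.
    by [].
  - move=> i iI; have := act k i; rewrite (negPf iI) => sneg.
    have ik : (numeq k <= i)%N by move: iI; rewrite inE negb_or -leqNgt => /andP[].
    have [_ _ /eqP] := ineqs i ik; rewrite mulf_eq0 => /orP[/eqP//|].
    by rewrite -[con _ _ - _]/(slack i (p, (x, l))) lt_eqF.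
case: q act => p [x l] act H k; have [grad act0 inact] := H k; split.
- apply/colP => a; have := grad_lagrangianE a (p, (x, l)).
  by rewrite grad add0r => ->.
- move=> i ik; have iI : i \in I1b k by rewrite inE ik.
  by have /eqP := act0 i iI; rewrite subr_eq0 => /eqP.
- move=> i ik; have := act k i; case: ifPn => iI h.
    have /eqP s0 := act0 i iI; rewrite subr_eq0 in s0.
    by rewrite (eqP s0) subrr mulr0 lexx; split => //; exact/ltW/h.
  by rewrite (inact i iI) lexx mul0r; split => //; rewrite -subr_le0; exact/ltW.
Qed.

Lemma licq_indep k (mu : 'I_(dimg k) -> R) :
  LICQ pbar xbar lbar k -> (forall i, i \notin I1b k -> mu i = 0) ->
  (forall a, \sum_j mu j * grad_con pbar xbar j a 0 = 0) -> forall j, mu j = 0.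
Proof.
move=> licq mu0 sum0 j.
have [jS|jS] := boolP (j \in I1b k :|: I2 pbar xbar lbar k)%SET; last first.
  by apply: mu0; apply: contraNN jS => jI; rewrite inE jI.
apply: (free_image licq) jS.
apply/colP => a; rewrite summxE mxE -[RHS](sum0 a) big_mkcond; apply: eq_bigr => i _.
case: ifPn => [_|iS]; first by rewrite mxE.
by rewrite mu0 ?mul0r//; apply: contraNN iS => iI; rewrite inE iI.
Qed.

(** * Injectivity of the KKT Jacobian and the localization *)

Section Regular.
Variable B : forall k : player, 'M[R]_(dimx k, dimx k - #|I1b k|).
Hypothesis basisB : forall k, columns_basis_of_M pbar xbar lbar (B k).
Hypothesis licq : forall k, LICQ pbar xbar lbar k.
Hypothesis sosc : forall k, SOSC pbar xbar lbar k.
Variable alpha : player -> player -> R.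
Hypothesis alpha_gt0 : forall i j, j != i -> 0 < alpha i j.
Hypothesis alpha_sum : forall i, \sum_(j | j != i) alpha i j = 1.
Local Notation H := (hess_lagrangian pbar xbar lbar).
Local Notation A := (Amx pbar xbar lbar).
Hypothesis cond_iv : forall i k, i != k ->
  forall y : 'cV[R]_(dimx k), y != 0 -> Mspace pbar xbar lbar y ->
  0 < dot y ((H k k - (4 * alpha i k * alpha k i)^-1 *:
    ((A i k)^T *m B i *m invmx ((B i)^T *m H i i *m B i) *m (B i)^T *m A i k)) *m y).

(** With [I2] empty, the critical cone is the subspace [M^k]. *)
Lemma SOSC_Mspace k (y : 'cV[R]_(dimx k)) :
  y != 0 -> Mspace pbar xbar lbar y -> 0 < dot y (H k k *m y).
Proof.
by move=> y0 My; apply: sosc => //; split => // i; rewrite scsc inE.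
Qed.

Lemma reduced_hess_pos k z : z != 0 -> 0 < dot z (((B k)^T *m H k k *m B k) *m z).
Proof.
move=> z0; rewrite -!mulmxA dot_mulmx trmxK; apply: SOSC_Mspace.
  by apply: contraNneq z0 => /(free_cols_inj (basisB k).1) ->.
by apply/(basisB k).2/span_cols; exists z.
Qed.

Lemma jacobian_inj (y : strategy G) (m : multiplier G) :
  (forall k a, 'D_((0, (y, m)) : pt) ('D_(@dirx k (delta_mx a 0)) (lag k)) qbar = 0) ->
  (forall k (i : 'I_(dimg k)), i \in I1b k -> 'D_((0, (y, m)) : pt) (slack i) qbar = 0) ->
  (forall k (i : 'I_(dimg k)), i \notin I1b k -> lamk m k i 0 = 0) ->
  y = 0 /\ m = 0.
Proof.
move=> Dlag Dslack m0.
have My k : Mspace pbar xbar lbar (xk y k).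
  by move=> i iI; rewrite -(derive_slack i qbar y m) Dslack.
have Dlag' k a : (\sum_i H k i *m xk y i) a 0 +
    \sum_j lamk m k j 0 * grad_con pbar xbar j a 0 = 0.
  by rewrite -(derive_grad_lag a qbar y m) Dlag.
have Q0 : \sum_k \sum_i dot (xk y k) (H k i *m xk y i) = 0.
  apply: big1 => k _.
  have : \sum_a xk y k a 0 * ((\sum_i H k i *m xk y i) a 0 +
      \sum_j lamk m k j 0 * grad_con pbar xbar j a 0) = 0.
    by apply: big1 => a _; rewrite Dlag' mulr0.
  under eq_bigr do rewrite mulrDr.
  rewrite big_split /= [X in _ + X](_ : _ = 0) ?addr0.
    move=> E0; rewrite -[RHS]E0; under [RHS]eq_bigr do rewrite summxE big_distrr.
    rewrite [RHS]exchange_big; apply: eq_bigr => i _.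
    by rewrite dotE.
  (* Active terms vanish because [y^k] lies in [M^k], inactive ones because their [m] component is
     zero. *)
  transitivity (\sum_j lamk m k j 0 * dot (grad_con pbar xbar j) (xk y k)).
    under eq_bigr do rewrite big_distrr.
    rewrite exchange_big; apply: eq_bigr => j _; rewrite dotE big_distrr.
    by apply: eq_bigr => a _ /=; rewrite mulrC -mulrA.
  apply: big1 => j _; have [jI|jI] := boolP (j \in I1b k).
    by rewrite (My k j jI) mulr0.
  by rewrite m0// mul0r.
have xk0 k : xk y k = 0.
  apply: contrapT => /eqP yk0.
  have BM i (x : 'cV[R]_(dimx i)) : Mspace pbar xbar lbar x -> exists z, x = B i *m z.
    by move=> Mx; apply/span_cols/(basisB i).2.
  have := pairwise_posdef (fun i => hess_lagrangian_sym i qbar) BM reduced_hess_pos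
    alpha_gt0 alpha_sum cond_iv My (ex_intro _ k yk0).
  by rewrite Q0 ltxx.
split.
  by rewrite (sum_emb y); apply: big1 => k _; rewrite -/(xk y k) xk0 emb0.
apply/mxcolP => k; rewrite submxcol0; apply/colP => j; rewrite -/(lamk m k) [RHS]mxE.
apply: (@licq_indep k (fun j => lamk m k j 0)) => // [i|a]; first exact: m0.
have := Dlag' k a; rewrite summxE big1 ?add0r// => i _.
by rewrite xk0 mulmx0 mxE.
Qed.

Local Notation N := ((\sum_(j < nplayers G) dimx j) + (\sum_(j < nplayers G) dimg j))%N.

(* Near the reference point the KKT system amounts to the vanishing of these
   functions, as many as there are coordinates in [(x, lambda)]. *)
Definition kkt_eq (i : 'I_N) (q : pt) : R :=
  match fintype.split i with
  | inl a => let s := tagnat.sig a in 'D_(@dirx (tag s) (delta_mx (tagged s) 0)) (lag (tag s)) q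
  | inr b => let s := tagnat.sig b in
      if tagged s \in I1b (tag s) then slack (tagged s) q else lamk q.2.2 (tag s) (tagged s) 0
  end.

Lemma kkt_eq_lag k a : kkt_eq (lshift _ (tagnat.Rank k a)) = 'D_(@dirx k (delta_mx a 0)) (lag k).
Proof.
by apply: funext => q; rewrite /kkt_eq (unsplitK (inl _)) /tagnat.Rank tagnat.rankK.
Qed.

Lemma kkt_eq_con k (i : 'I_(dimg k)) : kkt_eq (rshift _ (tagnat.Rank k i)) =
  if i \in I1b k then slack i else fun q => lamk q.2.2 k i 0.
Proof.
apply: funext => q; rewrite /kkt_eq (unsplitK (inr _)) /tagnat.Rank tagnat.rankK /=.
by case: ifP.
Qed.

(** Abstracting over [P] lets one decoding of the index serve both smoothness and vanishing. *)
Lemma kkt_eqP (P : (pt -> R) -> Prop) : (forall i, P (kkt_eq i)) <->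
  forall k, [/\ forall a, P ('D_(@dirx k (delta_mx a 0)) (lag k)),
    forall i, i \in I1b k -> P (slack i)
    & forall i, i \notin I1b k -> P (fun q : pt => lamk q.2.2 k i 0)].
Proof.
split=> [h k|h i].
  split=> [a|i iI|i iI]; first by rewrite -kkt_eq_lag.
    by have := h (rshift _ (tagnat.Rank k i)); rewrite kkt_eq_con iI.
  by have := h (rshift _ (tagnat.Rank k i)); rewrite kkt_eq_con (negPf iI).
rewrite -(splitK i); case: (fintype.split i) => j.
  by rewrite -[j]tagnat.sig2K kkt_eq_lag; have [+ _ _] := h (tagnat.sig1 j); apply.
rewrite -[j]tagnat.sig2K kkt_eq_con; have [_ h1 h2] := h (tagnat.sig1 j).
by case: ifPn => jI; [exact: h1|exact: h2].
Qed.

Lemma kkt_eq_C1 i : C1_on setT (kkt_eq i).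
Proof.
move: i; apply/(kkt_eqP (fun f => C1_on setT f)) => k; split=> [a|i _|i _].
- exact: (C2_lag k).2.
- exact: C2_C1 (C2_slack i).
- exact: C2_C1 (C2_contlin (contlin_coord i (contlin_lamk k))).
Qed.

Lemma SKKT_localization : C1_localization (@SKKT R G) pbar (xbar, lbar).
Proof.
(* The implicit function theorem solves for one column; [L] and [L'] split and stack it. *)
pose L (z : 'cV[R]_N) : strategy G * multiplier G := (usubmx z, dsubmx z).
pose L' (z : strategy G * multiplier G) : 'cV[R]_N := col_mx z.1 z.2.
have cL : contlin L.
  by apply: contlin_pair; apply: contlin_mx => a x y; rewrite linearP.
have cL' : contlin L'.
  split=> [a x y|z]; first by rewrite /L' scale_col_mx add_col_mx.
  apply: continuous_cV => i.
  rewrite -(splitK i); case: (fintype.split i) => j.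
    rewrite (_ : (fun _ => _) = (fun z : strategy G * multiplier G => z.1 j 0)).
      have := contlin_coord j (contlin_fst (strategy G) (multiplier G)).
      by case=> _; apply.
    by apply: funext => y; rewrite /L' /= col_mxEu.
  rewrite (_ : (fun _ => _) = (fun z : strategy G * multiplier G => z.2 j 0)).
    have := contlin_coord j (contlin_snd (strategy G) (multiplier G)).
    by case=> _; apply.
  by apply: funext => y; rewrite /L' /= col_mxEd.
have LK : cancel L L' by move=> z; rewrite /L /L' /= vsubmxK.
have LK' : cancel L' L by move=> [x l]; rewrite /L /L' /= col_mxKu col_mxKd.
apply: (C1_localization_iso cL cL' LK LK').
pose iota (z : param G * 'cV[R]_N) : pt := (z.1, L z.2).
have ciota : contlin iota.
  by apply: contlin_pair; [exact: contlin_fst|apply: contlin_comp cL; exact: contlin_snd].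
have iota0 : iota (pbar, L' (xbar, lbar)) = qbar by rewrite /iota /= LK'.
have near_act : \forall z \near (pbar, L' (xbar, lbar)), same_active (iota z).
  by have := ciota.2 (pbar, L' (xbar, lbar)); apply; rewrite iota0; exact: near_same_active.
have kkt q : same_active q -> SKKT q.1 q.2 <-> forall i, kkt_eq i q = 0.
  by move=> /SKKT_active ->; split=> [/(kkt_eqP (fun f => f q = 0))//|/(kkt_eqP (fun f => f q = 0))].
apply: (@implicit_function _ _ (fun i => kkt_eq i \o iota)).
- by move=> i; apply: (C1_comp_linear ciota.1 ciota.2); exact: kkt_eq_C1.
- move=> i /=; rewrite iota0; move: i; apply/kkt => //.
  exact: nbhs_singleton near_same_active.
- move=> z Dz.
  have Dz' i : 'D_((0, L z) : pt) (kkt_eq i) qbar = 0.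
    rewrite -iota0 -[RHS](Dz i); apply/esym/derive_comp_affine => h.
    by rewrite ciota.1.
  have [||//|z1 z2] := @jacobian_inj (usubmx z) (dsubmx z).
  + by move=> k a; have := Dz' (lshift _ (tagnat.Rank k a)); rewrite kkt_eq_lag.
  + by move=> k i iI; have := Dz' (rshift _ (tagnat.Rank k i)); rewrite kkt_eq_con iI.
  + move=> k i iI; have := Dz' (rshift _ (tagnat.Rank k i)); rewrite kkt_eq_con (negPf iI).
    by rewrite derive_linear//; exact: (contlin_coord i (contlin_lamk k)).1.
  + by rewrite -[z]vsubmxK z1 z2 col_mx0.
- by apply: filterS near_act => z act; exact: (kkt (iota z) act).
Qed.

End Regular.

(** * Local optimality of the KKT points near the reference point *)

Definition augmented (k : player) (r : R) (q : pt) : R :=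
  lag k q + \sum_(i in I1b k) r / 2 * (slack i \* slack i) q.

Lemma C2_augmented k r : C2 (augmented k r).
Proof.
apply: (C2D (f := lag k) (g := fun q => \sum_(i in I1b k) r / 2 * (slack i \* slack i) q)).
  exact: C2_lag.
apply: C2_sum => i _; exact: (C2M (C2_cst _ (r / 2)) (C2M (C2_slack i) (C2_slack i))).
Qed.

Lemma derive_augmented k r v q : 'D_v (augmented k r) q =
  'D_v (lag k) q + \sum_(i in I1b k) r / 2 * 'D_v (slack i \* slack i) q.
Proof.
have c2 (i : 'I_(dimg k)) : C2 (slack i \* slack i) by exact: C2M (C2_slack i) (C2_slack i).
have cs := C1_sum (index_enum _) (P := fun i => i \in I1b k)
  (fun i _ => C1M (C1_cst (r / 2)) (c2 i).1).
rewrite (_ : augmented k r = lag k \+ (fun q => \sum_(i in I1b k) r / 2 * (slack i \* slack i) q))//.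
rewrite (deriveD (diff_derivable (C1_differentiable q (C2_lag k).1))
  (diff_derivable (C1_differentiable q cs))); congr (_ + _).
rewrite derive_fun_sum; last by move=> i _; exact: (C1M (C1_cst (r / 2)) (c2 i).1).
by apply: eq_bigr => i _; exact: (derive_scale (r / 2) v q (c2 i).1).
Qed.

(* Finsler's lemma. *)
Lemma augmented_posdef k : SOSC pbar xbar lbar k ->
  exists2 r : R, 0 < r & forall d : 'cV[R]_(dimx k), d != 0 ->
    0 < 'D_(dirx d) ('D_(dirx d) (augmented k r)) qbar.
Proof.
move=> sosc; pose H := hess_lagrangian pbar xbar lbar k k.
pose g (i : 'I_(dimg k)) := grad_con pbar xbar i.
pose s (d : 'cV[R]_(dimx k)) := \sum_(i in I1b k) dot (g i) d ^+ 2.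
have [r r0 Hr] : exists2 r : R, 0 < r & forall d, sphere d -> 0 < dot d (H *m d) + r * s d.
  apply: (penalty_pos (@compact_sphere (dimx k))); first exact: continuous_dot_mulmx.
  - exact: continuous_sum_sqr_dot.
  - by move=> d; apply: sumr_ge0 => i _; exact: sqr_ge0.
  - move=> d; rewrite /sphere /= => d1 sd; apply: sosc.
      by rewrite -normr_eq0 d1 oner_eq0.
    split=> i iI; last by move: iI; rewrite scsc inE.
    move/eqP: sd; rewrite psumr_eq0; last by move=> j _; exact: sqr_ge0.
    by move=> /allP/(_ i); rewrite mem_index_enum iI sqrf_eq0 => /(_ isT)/eqP.
exists r => // d d0.
have slack0 i : i \in I1b k -> slack i qbar = 0.
  have act := nbhs_singleton near_same_active.
  by have [+ _] := SKKT_active act => /(_ KKTbar k)[_ + _]; apply.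
have -> : 'D_(dirx d) ('D_(dirx d) (augmented k r)) qbar = dot d (H *m d) + r * s d.
  rewrite (_ : 'D_(dirx d) (augmented k r) = 'D_(dirx d) (lag k) \+ (fun q =>
      \sum_(i in I1b k) r / 2 * 'D_(dirx d) (slack i \* slack i) q)); last first.
    by apply: funext => q; rewrite derive_augmented.
  have c2 (i : 'I_(dimg k)) : C2 (slack i \* slack i) by exact: C2M (C2_slack i) (C2_slack i).
  have cs (i : 'I_(dimg k)) := C1M (C1_cst (r / 2)) ((c2 i).2 (dirx d)).
  rewrite (deriveD (diff_derivable (C1_differentiable qbar ((C2_lag k).2 (dirx d))))
    (diff_derivable (C1_differentiable qbar
      (C1_sum (index_enum _) (P := fun i => i \in I1b k) (fun i _ => cs i))))).
  rewrite second_derivative_lag; congr (_ + _).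
  rewrite derive_fun_sum; last by move=> i _; exact: cs.
  (* The slack vanishes at [qbar], so its square has second derivative twice the squared first
     derivative; the factor [r / 2] turns this into [r]. *)
  rewrite /s big_distrr; apply: eq_bigr => i iI /=.
  rewrite (derive_scale (r / 2) (dirx d) qbar ((c2 i).2 (dirx d))).
  rewrite (second_derivative_sqr _ (C2_slack i) (slack0 i iI)) derive_slack.
  by rewrite /xk submxcol_emb mulrA divfK.
(* Both terms are homogeneous of degree two, so positivity on the sphere suffices. *)
have nd : 0 < `|d| by rewrite normr_gt0.
have := Hr (`|d|^-1 *: d); rewrite /sphere /= normrZ normfV normr_id mulVf ?gt_eqF//.
move=> /(_ erefl); rewrite -scalemxAr dotZr dotZl /s.
under eq_bigr do rewrite dotZr exprMn.
rewrite -big_distrr /= mulrA -expr2 mulrCA -mulrDr pmulr_rgt0//.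
by rewrite exprn_gt0// invr_gt0.
Qed.

Lemma near_best_response k : SOSC pbar xbar lbar k ->
  \forall q \near qbar, SKKT q.1 q.2 -> local_minimizer (@feasible R G q.1 k)
    (fun y => obj (deviate q.2.1 y, wk q.1 k) - dot (vk q.1 k) y) (xk q.2.1 k).
Proof.
move=> sosc; have [r r0 pos] := augmented_posdef sosc.
have := local_min_near (C2_augmented k r) (@dirx_linear k) pos.
apply: filterS2 near_same_active => q act locmin kktq.
have [+ _] := SKKT_active act => /(_ kktq k)[Dlag act0 inact].
(* A KKT point is critical for the augmented Lagrangian in the directions of player [k]: the
   derivative of a squared slack retains the vanishing slack as a factor. *)
have : \forall d \near (0 : 'cV[R]_(dimx k)),
    augmented k r q <= augmented k r (q + dirx d).
  apply: locmin => d; rewrite derive_augmented.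
  rewrite (derive_dir_delta _ (C1_differentiable q (C2_C1 (C2_lag k))) (@dirx_linear k)).
  rewrite !big1 ?addr0// => [i iI|a _]; last by rewrite Dlag scaler0.
  rewrite (derive_mul _ _ (C2_C1 (C2_slack i)) (C2_C1 (C2_slack i))) act0//.
  by rewrite !mul0r addr0 mulr0.
(* At [d = 0] the slack vanishes and the multiplier is positive, so continuity keeps the sum
   positive for small [d]. *)
have : \forall d \near (0 : 'cV[R]_(dimx k)), forall i, i \in I1b k -> (numeq k <= i)%N ->
    0 < lamk q.2.2 k i 0 + r / 2 * slack i (q + dirx d).
  apply: near_forall => i.
  have [iI|iI] := boolP (i \in I1b k); last exact: filterE.
  case: (leqP (numeq k) i) => ki; last exact: filterE.
  have l0 := act k i; rewrite iI ki in l0.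
  have c : {for 0, continuous (fun d : 'cV[R]_(dimx k) =>
      lamk q.2.2 k i 0 + r / 2 * slack i (q + dirx d))}.
    apply: continuous_affine.
    apply: (@continuous_comp _ _ _ (fun d => q + dirx d) (@slack k i)).
      apply: (@continuousD _ _ _ (cst q) (@dirx k)); first exact: cst_continuous.
      exact: linear_continuous_mx (@dirx_linear k) _.
    exact: C1_continuous (C2_C1 (C2_slack i)) _.
  have d0 : q + dirx (0 : 'cV[R]_(dimx k)) = q.
    by rewrite /dirx emb0 addr0.
  have h0 : 0 < lamk q.2.2 k i 0 + r / 2 * slack i (q + dirx (0 : 'cV[R]_(dimx k))).
    by rewrite d0 act0// mulr0 addr0; exact: l0.
  by apply: filterS (cvgr_gt _ c _ h0).
case: q act kktq Dlag act0 inact {locmin} => p [x l] act kktq Dlag act0 inact near1 near2.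
split.
  by have [_ eqs ineqs] := kktq k; split=> // i ki; have [] := ineqs i ki.
move: near1 near2 => /near_subr near1 /near_subr near2.
apply: filterS2 (near1 (xk x k)) (near2 (xk x k)) => y pos_y aug_y [eqs ineqs].
set d := y - xk x k in pos_y aug_y *.
have yE : y = xk x k + d by rewrite subrKC.
have qd : (p, (x, l)) + dirx d = (p, (x + emb d, l)) :> pt.
  by rewrite -[LHS]/(p + 0, (x + emb d, l + 0)) !addr0.
have xkd : xk (x + emb d) k = y by rewrite /xk submxcolD submxcol_emb -/(xk x k) -yE.
have dev0 : deviate x (xk x k) = x.
  by have := deviate_emb x (0 : 'cV[R]_(dimx k)); rewrite emb0 !addr0.
rewrite qd in pos_y aug_y.
have dev : deviate x y = x + emb d by rewrite yE deviate_emb.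
rewrite /= dev0 dev.
(* Complementarity and the vanishing active slacks remove every term except the perturbed
   objective. *)
have augq : augmented k r (p, (x, l)) = obj (x, wk p k) - dot (vk p k) (xk x k).
  rewrite /augmented /lag [X in _ + X]big1 ?addr0 => [|i iI]; last first.
    by rewrite /= act0// !mulr0.
  rewrite [X in _ + X]big1 ?addr0// => i _.
  have [iI|iI] := boolP (i \in I1b k); first by rewrite act0// mulr0.
  by rewrite inact// mul0r.
(* Multipliers of active inequalities dominate [r / 2] times the slack, so the
   augmented Lagrangian is below the objective at feasible points. *)
rewrite -augq; apply: (le_trans aug_y).
rewrite /augmented /lag /= xkd -[leRHS]addr0 -addrA lerD2l [X in _ + X <= _]big_mkcond -big_split /=.
apply: sumr_le0 => i _.
have sE : slack i (p, (x + emb d, l)) = con i (y, wk p k) - uk p k i 0 by rewrite /slack /= xkd.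
case: ifPn => iI; last by rewrite (inact i iI) mul0r addr0.
case: (leqP (numeq k) i) => ki; last first.
  by rewrite sE eqs// subrr !mulr0 addr0.
have := pos_y i iI ki; set t := slack _ _ => lt0.
rewrite [leLHS](_ : _ = t * (lamk l k i 0 + r / 2 * t)); last by rewrite /=; ring.
apply: mulr_le0_ge0; last exact: ltW.
by rewrite /t sE subr_le0 ineqs.
Qed.

End AtPoint.

End Game.

End Reals.

Theorem corollary4p1 (R : realType) (G : nep R)
    (obj_C2 : forall k : 'I_(nplayers G), C2 (obj (n:=G) (k:=k)))
    (con_C2 : forall (k : 'I_(nplayers G)) (i : 'I_(dimg k)), C2 (con i))
    (pbar : param G) (xbar : strategy G) (lbar : multiplier G)
    (KKTbar : SKKT pbar (xbar, lbar))
    (B : forall k : 'I_(nplayers G),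
       'M[R]_(dimx k, dimx k - #|I1 pbar xbar lbar k|))
    (basisB : forall k, columns_basis_of_M pbar xbar lbar (B k))
    (scsc : forall k, SCSC pbar xbar lbar k)
    (licq : forall k, LICQ pbar xbar lbar k)
    (sosc : forall k, SOSC pbar xbar lbar k)
    (iv : exists alpha : 'I_(nplayers G) -> 'I_(nplayers G) -> R,
       [/\ forall i j, j != i -> 0 < alpha i j,
           forall i, \sum_(j | j != i) alpha i j = 1
         & forall i k, i != k ->
           forall y : 'cV[R]_(dimx k), y != 0 -> Mspace pbar xbar lbar y ->
           let H := hess_lagrangian pbar xbar lbar in
           let A := Amx pbar xbar lbar in
           0 < dot y ((H k k
                 - (4 * alpha i k * alpha k i)^-1 *:
                   ((A i k)^T *m B i *m invmx ((B i)^T *m H i i *m B i)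
                      *m (B i)^T *m A i k)) *m y)]) :
  C1_localization (@SKKT R G) pbar (xbar, lbar) /\
  \forall q \near (pbar, (xbar, lbar)), SKKT q.1 q.2 -> LNE q.1 q.2.1.
Proof.
split.
  have [alpha [alpha_gt0 alpha_sum cond_iv]] := iv.
  exact: (SKKT_localization obj_C2 con_C2 KKTbar scsc basisB licq sosc
    alpha_gt0 alpha_sum cond_iv).
(* There are finitely many players, so their neighbourhoods can be intersected. *)
have : \forall q \near (pbar, (xbar, lbar)), forall k, SKKT q.1 q.2 ->
    local_minimizer (@feasible R G q.1 k)
      (fun y => obj (deviate q.2.1 y, wk q.1 k) - dot (vk q.1 k) y) (xk q.2.1 k).
  by apply: near_forall => k; exact: near_best_response.
by apply: filterS => q best kktq k; exact: best.
Qed.
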